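(* Let $n\ge5$, $d\ge3$, and let $0\ne f\in\operatorname{Sym}^d(P_n^* )=\mathbb C[x_1,\dots,x_n]_d$, where $P_n=\mathbb C^n$ is the natural permutation module of $S_n$. Then $J(f)$ is $S_n$-invariant if and only if $f$ belongs to one of the following families: (i) The line $\mathbb C f$ is $S_n$-invariant, that is, $f$ is symmetric or alternating. (ii) $f=a s^d+h$, where $s=x_1+\cdots+x_n$, $a\in\mathbb C$, and $h$ is the inflation to $P_n$ of a degree-$d$ form on $H_n$ which is either $S_n$-invariant or $\operatorname{sgn}$-relative invariant. (iii) $f=\sum_{i=1}^n c_i\ell_i^d$, where $c_i\in\mathbb C^\times$ and $$\ell_i=x_i+\gamma s,\qquad s=x_1+\cdots+x_n,\qquad \gamma\in\mathbb C,\quad 1+n\gamma\ne0 .$$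
   Context: $S_n$ acts on $P_n=\mathbb C^n$ by permuting coordinates. One has $P_n=T\oplus H_n$ as $S_n$-modules, where $T=\mathbb C t$, $t=(1,\dots,1)$, and $H_n=\{(x_1,\dots,x_n)\in\mathbb C^n:x_1+\cdots+x_n=0\}$. $x_1,\dots,x_n$ are the coordinate functions on $P_n$. The inflation to $P_n$ of a form on $H_n$ is its pullback along the projection $P_n=T\oplus H_n\to H_n$. The group acts on forms by $(\sigma\cdot h)(x)=h(\sigma^{-1}x)$; a form $h$ is $\operatorname{sgn}$-relative invariant (for $P_n$: alternating) if $\sigma\cdot h=\operatorname{sgn}(\sigma)h$ for all $\sigma\in S_n$. For $v\in P_n$, $D_v$ is directional differentiation, and the Jacobian of $f$ is $J(f)=\langle D_vf:v\in P_n\rangle\subseteq\operatorname{Sym}^{d-1}(P_n^* )$; it is $S_n$-invariant if $\sigma\cdot J(f)=J(f)$ for all $\sigma\in S_n$. *)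

(* Defs.v *)
(* The complex numbers are R[i] for R : realType. *)
From HB Require Import structures.
From mathcomp Require Import all_boot all_order all_fingroup all_algebra.
From mathcomp Require Import classical_sets reals complex.
From mathcomp Require Import mpoly.

Set Implicit Arguments.
Unset Strict Implicit.
Unset Printing Implicit Defensive.

Import GRing.Theory.

Local Open Scope ring_scope.

Section PermutationModule.
Variables (R : realType) (n : nat).
Local Notation C := (R[i]).
Local Notation P := 'rV[C]_n.

(* [permV s] sends e_i to e_(s i), so [permV s^-1 x] is x o s. *)
Definition permV (s : 'S_n) (x : P) : P := col_perm s^-1 x.

Lemma permVE (s : 'S_n) (x : P) i : permV s x 0 i = x 0 ((s^-1)%g i).
Proof. by rewrite mxE. Qed.

Definition evalP (p : {mpoly C[n]}) (x : P) : C := p.@[fun i => x 0 i].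

(* [msym s] substitutes X_(s i) for X_i, so (s . h)(x) = h(s^-1 x). *)
Lemma evalP_msym (s : 'S_n) (p : {mpoly C[n]}) (x : P) :
  evalP (msym s p) x = evalP p (permV s^-1 x).
Proof.
rewrite /evalP; elim/mpolyind: p => [|c m p _ _ IH]; first by rewrite !raddf0.
rewrite !raddfD /= IH; congr (_ + _); rewrite linearZ /= !mevalZ; congr (_ * _).
rewrite msymX !mevalX (reindex_inj (@perm_inj _ s)) /=.
by apply: eq_bigr => i _; rewrite mnmE permK permVE invgK.
Qed.

Definition Tn : {vspace P} := <[const_mx 1]>%VS.

Definition Hn : {vspace P} := lker (linfun (mulmxr (const_mx 1 : 'cV[C]_n))).

Lemma memHn (x : P) : (x \in Hn) = (\sum_i x 0 i == 0).
Proof.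
have xE i j : (x *m (const_mx 1 : 'cV[C]_n)) i j = \sum_k x 0 k.
  by rewrite mxE; apply: eq_bigr => k _; rewrite !ord1 mxE mulr1.
rewrite memv_ker lfunE /=; apply/eqP/eqP => [x0|x0]; first
  by rewrite -(xE 0 0) x0 mxE.
by apply/matrixP => i j; rewrite xE x0 mxE.
Qed.

(* [daddv_pi Hn Tn] is the projection onto Hn along Tn. *)
Definition projHn (x : P) : subvs_of Hn := vsproj Hn (daddv_pi Hn Tn x).

Lemma projHnE (x : P) : (0 < n)%N ->
  vsval (projHn x) = x - const_mx ((\sum_i x 0 i) / n%:R).
Proof.
move=> n_gt0.
have n0 : n%:R != 0 :> C by rewrite Num.Theory.pnatr_eq0 -lt0n.
have sumc (c : C) : \sum_(i < n) (const_mx c : P) 0 i = c * n%:R.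
  under eq_bigr do rewrite mxE.
  by rewrite sumr_const card_ord mulr_natr.
have HT : (Hn :&: Tn = 0)%VS.
  apply/eqP; rewrite -subv0; apply/subvP => y; rewrite memv_cap memHn.
  case/andP => sy /vlineP[k yE]; move: sy; rewrite yE memv0.
  have -> : k *: const_mx 1 = const_mx k :> P.
    by apply/matrixP => i j; rewrite !mxE mulr1.
  by rewrite sumc mulf_eq0 (negPf n0) orbF => /eqP->; apply/eqP/matrixP => i j;
    rewrite !mxE.
rewrite vsprojK ?memv_pi //.
set c := _ / _.
have xE : x = (x - const_mx c) + const_mx c by rewrite subrK.
rewrite {1}xE linearD /= daddv_pi_id //; last first.
  rewrite memHn; under eq_bigr do rewrite !mxE.
  by rewrite sumrB sumr_const card_ord -mulr_natr divfK // subrr.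
have cT : const_mx c \in Tn.
  by apply/vlineP; exists c; apply/matrixP => i j; rewrite !mxE mulr1.
have TH : (Tn :&: Hn = 0)%VS by rewrite capvC.
have := daddv_pi_add HT (memv_add (mem0v Hn) cT).
rewrite add0r (daddv_pi_id TH cT) => /(congr1 (fun z => z - const_mx c)).
by rewrite addrK subrr => ->; rewrite addr0.
Qed.

Definition permHn (s : 'S_n) (y : subvs_of Hn) : subvs_of Hn :=
  vsproj Hn (permV s (vsval y)).

Lemma permHnE (s : 'S_n) (y : subvs_of Hn) :
  vsval (permHn s y) = permV s (vsval y).
Proof.
rewrite vsprojK // memHn; have := subvsP y; rewrite memHn.
rewrite (reindex_inj (@perm_inj _ (s^-1)%g)) /= => y0.
by under eq_bigr do rewrite permVE.
Qed.

(* Degree-d forms on Hn, as polynomial functions; since the restriction map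
   from linear forms on P to linear forms on Hn is onto, these are exactly the
   restrictions to Hn of the degree-d forms on P. *)
Definition formHn (d : nat) (g : subvs_of Hn -> C) : Prop :=
  exists2 p : {mpoly C[n]}, p \is d.-homog & forall y, g y = evalP p (vsval y).

Definition invariantHn (g : subvs_of Hn -> C) : Prop :=
  forall (s : 'S_n) y, g (permHn s^-1 y) = g y.

Definition sgn_invariantHn (g : subvs_of Hn -> C) : Prop :=
  forall (s : 'S_n) y, g (permHn s^-1 y) = (-1) ^+ s * g y.

Definition inflation (g : subvs_of Hn -> C) (h : {mpoly C[n]}) : Prop :=
  forall x : P, evalP h x = g (projHn x).

Definition alternating (f : {mpoly C[n]}) : Prop :=
  forall s : 'S_n, msym s f = (-1) ^+ s *: f.

Definition dird (v : P) (f : {mpoly C[n]}) : {mpoly C[n]} :=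
  \sum_i v 0 i *: f^`M(i).

Definition spanset (A : set {mpoly C[n]}) : set {mpoly C[n]} :=
  [set q | exists (k : nat) (c : 'I_k -> C) (g : 'I_k -> {mpoly C[n]}),
     (forall j, A (g j)) /\ q = \sum_j c j *: g j]%classic.

Definition jacobian (f : {mpoly C[n]}) : set {mpoly C[n]} :=
  spanset (range (fun v : P => dird v f)).

Definition Sn_invariant (A : set {mpoly C[n]}) : Prop :=
  forall s : 'S_n, (msym s @` A = A)%classic.

Definition sumX : {mpoly C[n]} := \sum_(i < n) 'X_i.

Definition line_invariant (f : {mpoly C[n]}) : Prop :=
  Sn_invariant (spanset [set f]%classic).

Definition split_family (d : nat) (f : {mpoly C[n]}) : Prop :=
  exists (a : C) (h : {mpoly C[n]}) (g : subvs_of Hn -> C),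
    [/\ formHn d g, invariantHn g \/ sgn_invariantHn g, inflation g h
      & f = a *: sumX ^+ d + h].

Definition powers_family (d : nat) (f : {mpoly C[n]}) : Prop :=
  exists (c : 'I_n -> C) (gamma : C),
    [/\ forall i, c i != 0, 1 + n%:R * gamma != 0
      & f = \sum_(i < n) c i *: ('X_i + gamma *: sumX) ^+ d].

End PermutationModule.

(* Main.v *)
(* Write D_v for the derivative of f along v.  If no D_v f vanishes, the matrices
   A that are self-adjoint for all the forms (v, w) |-> D_v D_w f commute (for
   d >= 3, by symmetry of third derivatives), and when J(f) is S_n-invariant they
   contain the matrices M_s with D_v (s . f) = D_(v M_s) f and are stable under
   conjugation by permutations.  So the conjugates of the M_s have a common
   eigenvector v.  If a transposition moves the eigencharacter of v, the distinct
   lines among those spanned by the permutations of v are independent, and for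
   n >= 5 this forces v to be proportional to some e_i + g t; these form an
   eigenbasis with distinct characters, hence D_u D_w f = 0 for distinct basis
   vectors u, w, and f is a sum of powers of the dual linear forms.  Otherwise the
   character is S_n-invariant; using the trivial and standard submodules, on
   vectors and on covectors, each M_s becomes chi + c J with J the all-one matrix.
   Then either all c vanish and C f is stable, or D_t D_w f = 0 for all w of zero
   sum and f = a s^d + h.  If instead D_t f = 0, the same analysis applies to
   f + s^d, for which the sum-of-powers case is excluded. *)
Require Import Defs.
From HB Require Import structures.
From mathcomp Require Import all_boot all_order all_fingroup all_algebra.
From mathcomp Require Import classical_sets reals complex.
From mathcomp Require Import mpoly spectral ring.
Import GRing.Theory.
Local Open Scope ring_scope.

Set Implicit Arguments.
Unset Strict Implicit.
Unset Printing Implicit Defensive.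

(** * Vectors of the permutation module and rigidity under permutations *)

Section PermutationVectors.
Variables (F : numFieldType) (n : nat).
Implicit Types (u v w : 'rV[F]_n) (s : 'S_n) (i j k l : 'I_n).

Local Notation e i := (delta_mx 0 i : 'rV[F]_n).

Lemma mulmx_permE v s i : (v *m perm_mx s) 0 i = v 0 ((s^-1)%g i).
Proof. by rewrite -[s]invgK -col_permE mxE invgK. Qed.

Lemma mulmx_tpermE v i j k : (v *m perm_mx (tperm i j)) 0 k = v 0 (tperm i j k).
Proof. by rewrite mulmx_permE tpermV. Qed.

Lemma mulmx_permK m (A : 'M[F]_(m, n)) s : A *m perm_mx s *m perm_mx s^-1 = A.
Proof. by rewrite -mulmxA -(perm_mxM _ s) mulgV perm_mx1 mulmx1. Qed.

Lemma mulmx_permVK m (A : 'M[F]_(m, n)) s : A *m perm_mx s^-1 *m perm_mx s = A.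
Proof. by rewrite -mulmxA -(perm_mxM _ _ s) mulVg perm_mx1 mulmx1. Qed.

(** The source of the linear relations below between transposed copies of [v]: they reduce to
    relations among the [e i - e j]. *)
Lemma tperm_subE v i j :
  v - v *m perm_mx (tperm i j) = (v 0 i - v 0 j) *: (e i - e j).
Proof.
apply/rowP => k; rewrite 2!mxE mulmx_tpermE !mxE !eqxx !andTb.
case: tpermP => [->|->|/eqP/negPf-> /eqP/negPf->].
- by have [->|ij] := eqVneq i j; rewrite eqxx /=; ring.
- by have [->|ij] := eqVneq j i; rewrite eqxx /=; ring.
by rewrite !subrr mulr0.
Qed.

Lemma fresh_ord (r : seq 'I_n) : (size r < n)%N -> exists l, l \notin r.
Proof.
move=> lt_rn; have /subsetPn[l _ lr] : ~~ ([set: 'I_n] \subset r).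
  apply/negP => /subset_leq_card; rewrite cardsT card_ord.
  by move=> /leq_trans/(_ (card_size r)); rewrite leqNgt lt_rn.
by exists l.
Qed.

(* Abstracts the situation where the lines spanned by the permutations of [v]
   are eigenlines with pairwise distinct eigencharacters. *)
Definition perm_rigid v := forall s (r : seq (F * 'S_n)),
  v *m perm_mx s = \sum_(x <- r) x.1 *: (v *m perm_mx x.2) ->
  exists2 x, x \in r & exists c, v *m perm_mx s = c *: (v *m perm_mx x.2).

(** The identity [e i - e j = (e i - e k) - (e j - e k)] expresses the copy of [v] under [tperm i j]
    through [v] and its copies under [tperm i k] and [tperm j k]; rigidity then singles out one of
    the three. *)
Lemma perm_rigid_triple v i j k : perm_rigid v ->
    v 0 i != v 0 j -> v 0 j != v 0 k -> v 0 i != v 0 k ->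
  exists2 s, s \in [:: 1%g; tperm i k; tperm j k] &
  exists c, forall l, v 0 (tperm i j l) = c * v 0 ((s^-1)%g l).
Proof.
move=> rv vij vjk vik.
have ij : i != j by apply: contraNneq vij => ->.
have jk : j != k by apply: contraNneq vjk => ->.
have ik : i != k by apply: contraNneq vik => ->.
pose a := v 0 i; pose b := v 0 j; pose c := v 0 k.
have ac : a - c != 0 by rewrite subr_eq0.
have bc : b - c != 0 by rewrite subr_eq0.
have [|x xr [z vz]] := rv (tperm i j) [::
    (1 - (a - b) / (a - c) + (a - b) / (b - c), 1%g);
    ((a - b) / (a - c), tperm i k); (- ((a - b) / (b - c)), tperm j k)].
  rewrite !big_cons big_nil /= perm_mx1 mulmx1 addr0.
  have Eik := tperm_subE v i k; have Ejk := tperm_subE v j k.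
  have Eij := tperm_subE v i j.
  have D w x y : w - x = y -> x = w - y by move=> <-; rewrite opprB addrC subrK.
  rewrite (D _ _ _ Eij) (D _ _ _ Eik) (D _ _ _ Ejk) -/a -/b -/c.
  by apply/rowP => l; rewrite !mxE; field; rewrite ac bc.
exists x.2; first by move: xr; rewrite !inE => /or3P[] /eqP->; rewrite /= eqxx ?orbT.
by exists z => l; move/rowP/(_ l): vz; rewrite mulmx_tpermE mxE mulmx_permE.
Qed.

(** All permutations involved fix [l], so a nonzero [v 0 l] would force the proportionality factor
    1, and two of the three values would agree. *)
Lemma perm_rigid_triple0 v i j k l : perm_rigid v ->
    v 0 i != v 0 j -> v 0 j != v 0 k -> v 0 i != v 0 k ->
    l \notin [:: i; j; k] -> v 0 l = 0.
Proof.
move=> rv vij vjk vik; rewrite !inE !negb_or => /and3P[li lj lk].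
have ik : i != k by apply: contraNneq vik => ->.
have ij : i != j by apply: contraNneq vij => ->.
have jk : j != k by apply: contraNneq vjk => ->.
have [s sr [c vs]] := perm_rigid_triple rv vij vjk vik.
apply/eqP/negP => /negP vl0.
have : v 0 l = c * v 0 l.
  rewrite -{1}[l](@tpermD _ i j) 1?eq_sym // vs.
  by move: sr; rewrite !inE => /or3P[] /eqP->; rewrite ?invg1 ?perm1 ?tpermV // tpermD // eq_sym.
move/esym/(canRL (mulfK vl0)); rewrite divff // => c1.
move: sr; rewrite !inE => /or3P[] /eqP sE; move: vs; rewrite sE c1.
- by move/(_ i); rewrite tpermL invg1 perm1 mul1r => /eqP; rewrite eq_sym (negPf vij).
- move/(_ k); rewrite tpermV tpermR tpermD // mul1r => /eqP.
  by rewrite eq_sym (negPf vik).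
move/(_ k); rewrite tpermV tpermR tpermD // mul1r => /eqP.
by rewrite eq_sym (negPf vjk).
Qed.

(** A third value forces a zero entry at a fresh [l]. Two of the three values are nonzero and
    distinct; in the triple relation for these two and the zero entry, the entries at the exchanged
    positions exclude every alternative. *)
Lemma perm_rigid_two_values v i j k : (4 < n)%N -> perm_rigid v ->
  v 0 i != v 0 j -> (v 0 k == v 0 i) || (v 0 k == v 0 j).
Proof.
move=> n5 rv vij; apply/negPn/negP; rewrite negb_or => /andP[vki vkj].
have [l lr] : exists l, l \notin [:: i; j; k] by apply: fresh_ord; apply: leq_trans n5.
have vl : v 0 l = 0 by apply: perm_rigid_triple0 lr => //; rewrite eq_sym.
suff [p [q [vp vq vpq]]] : exists p q, [/\ v 0 p != 0, v 0 q != 0 & v 0 p != v 0 q].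
  have vql : v 0 q != v 0 l by rewrite vl.
  have vlp : v 0 l != v 0 p by rewrite vl eq_sym.
  have vqp : v 0 q != v 0 p by rewrite eq_sym.
  have [s sr [c vs]] := perm_rigid_triple rv vql vlp vqp.
  have pl : p != l by apply: contraNneq vlp => ->.
  have ql : q != l by apply: contraNneq vql => ->.
  have qp : q != p by apply: contraNneq vqp => ->.
  move: (vs l) (vs q); rewrite tpermR tpermL vl => vsl vsq.
  move: sr; rewrite !inE => /or3P[] /eqP sE; move: vsl vsq; rewrite sE.
  - by rewrite invg1 perm1 vl mulr0 => /eqP; rewrite (negPf vq).
  - by rewrite tpermV tpermD // vl mulr0 => /eqP; rewrite (negPf vq).
  rewrite tpermV tpermL (tpermD (z := q)) // 1?eq_sym // => vqc /esym/eqP.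
  by rewrite mulf_eq0 (negPf vq) orbF => /eqP c0; move: vq; rewrite vqc c0 mul0r eqxx.
have [vi0|vi0] := eqVneq (v 0 i) 0.
  by exists j, k; rewrite -vi0 eq_sym vij vki eq_sym vkj.
have [vj0|vj0] := eqVneq (v 0 j) 0.
  by exists i, k; rewrite vi0 -vj0 vkj eq_sym.
by exists i, j.
Qed.

(** The four differences between an index in [i, i'] and one in [j, j'] carry the same coefficient,
    so their alternating relation becomes one between transposed copies of [v]. A fifth index fixes
    the factor in the case [tperm i' j']. *)
Lemma perm_rigid_split v i i' j j' : (4 < n)%N -> perm_rigid v ->
  v 0 i != v 0 j -> v 0 i' = v 0 i -> v 0 j' = v 0 j -> i' != i -> j' != j -> False.
Proof.
move=> n5 rv vij vi' vj' ii' jj'.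
have [l lr] : exists l, l \notin [:: i; j; i'; j'] by apply: fresh_ord.
move: lr; rewrite !inE !negb_or => /and4P[li lj li' lj'].
have ij : i != j by apply: contraNneq vij => ->.
have ij' : i != j' by apply: contraNneq vij => ->; rewrite vj'.
have i'j : i' != j by apply: contraNneq vij => <-; rewrite vi'.
have i'j' : i' != j' by rewrite -vj' -vi' in vij; apply: contraNneq vij => ->.
pose a := v 0 i; pose b := v 0 j.
have [|x xr [c vx]] := rv (tperm i j) [:: (1, tperm i' j); (-1, tperm i' j'); (1, tperm i j')].
  rewrite !big_cons big_nil /= addr0.
  have D p q : v *m perm_mx (tperm p q) = v - (v 0 p - v 0 q) *: (e p - e q).
    by rewrite -tperm_subE opprB addrC subrK.
  rewrite !D vi' vj' -/a -/b; apply/rowP => k; rewrite !mxE; ring.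
have vxE k : v 0 (tperm i j k) = c * v 0 ((x.2^-1)%g k).
  by move/rowP/(_ k): vx; rewrite mulmx_tpermE mxE mulmx_permE.
have xE : x.2 \in [:: tperm i' j; tperm i' j'; tperm i j'].
  by move: xr; rewrite !inE => /or3P[] /eqP->; rewrite /= eqxx ?orbT.
have := vxE l; rewrite tpermD 1?eq_sym // => vl.
have {}vl : v 0 l = c * v 0 l.
  by move: vl xE; rewrite !inE => vl /or3P[] /eqP xE; move: vl; rewrite xE tpermV tpermD // eq_sym.
move: (vxE i) (vxE j); rewrite tpermL tpermR.
move: xE; rewrite !inE => /or3P[] /eqP->; rewrite tpermV.
- rewrite tpermR tpermD // 1?eq_sym // vi' => <- vji.
  by rewrite vji eqxx in vij.
- rewrite !tpermD // 1?eq_sym // => vjc vic.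
  have [vl0|vl0] := eqVneq (v 0 l) 0.
    have := perm_rigid_two_values l n5 rv vij; rewrite vl0 => /orP[] /eqP v0.
      by rewrite vjc -v0 mulr0 eqxx in vij.
    by rewrite vic -v0 mulr0 eqxx in vij.
  have c1 : c = 1 by apply/esym/(mulIf vl0); rewrite mul1r.
  by rewrite vic c1 mul1r eqxx in vij.
rewrite tpermL tpermD // 1?eq_sym // vj' => <- vij'.
by rewrite vij' eqxx in vij.
Qed.

Lemma perm_rigid_shape v : (4 < n)%N -> perm_rigid v ->
  (exists a, v = const_mx a) \/
  (exists i a b, b != 0 /\ v = const_mx a + b *: e i).
Proof.
move=> n5 rv.
have [/existsP[i /existsP[j vij]]|/existsPn vc] :=
    boolP [exists i, exists j, v 0 i != v 0 j]; last first.
  left; have [l _] : exists l, l \notin [::] by apply: (@fresh_ord [::]); apply: leq_trans n5.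
  exists (v 0 l); apply/rowP => k; rewrite mxE.
  by have /existsPn/(_ l) := vc k; rewrite negbK => /eqP.
right.
have two := fun k => perm_rigid_two_values k n5 rv vij.
have [/existsP[i' /andP[/eqP vi' ii']]|/existsPn vi] := boolP [exists k, (v 0 k == v 0 i) && (k != i)].
  exists j, (v 0 i), (v 0 j - v 0 i); split; first by rewrite subr_eq0 eq_sym.
  apply/rowP => k; rewrite !mxE eqxx /=; have [->|kj] := eqVneq k j.
    by rewrite mulr1 addrC subrK.
  rewrite mulr0 addr0; have /orP[/eqP//|/eqP vk] := two k.
  by case: (perm_rigid_split n5 rv vij vi' vk ii' kj).
exists i, (v 0 j), (v 0 i - v 0 j); split; first by rewrite subr_eq0.
apply/rowP => k; rewrite !mxE eqxx /=; have [->|ki] := eqVneq k i.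
  by rewrite mulr1 addrC subrK.
rewrite mulr0 addr0; have /orP[/eqP vk|/eqP//] := two k.
by have := vi k; rewrite vk eqxx ki.
Qed.

(** Subtracting from a vector its copy under [tperm p q] isolates [e p - e q] when the two entries
    differ. [P] is a predicate so that it can also describe kernels of derivatives and families of
    rank-one matrices. *)
Lemma perm_stable_subspace (P : 'rV[F]_n -> Prop) u i j :
    (forall a v w, P v -> P w -> P (a *: v + w)) ->
    (forall p q v, P v -> P (v *m perm_mx (tperm p q))) ->
    P u -> u 0 i != u 0 j ->
  forall k l, P (e k - e l).
Proof.
move=> Plin Pperm Pu uij.
have P0 : P 0 by have := Plin (-1) _ _ Pu Pu; rewrite scaleN1r addNr.
have step v p q : P v -> v 0 p != v 0 q -> P (e p - e q).
  move=> Pv; rewrite -subr_eq0 => vpq.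
  rewrite -[e p - e q](scalerK vpq) -tperm_subE -[_ *: _]addr0; apply: (Plin _ _ _ _ P0).
  by rewrite addrC -scaleN1r; apply/(Plin _ _ _ _ Pv)/Pperm.
have ij : i != j by apply: contraNneq uij => ->.
have eij := step _ _ _ Pu uij.
have ej l : P (e j - e l).
  have [->|lj] := eqVneq l j; first by rewrite subrr.
  apply: (step _ _ _ eij); rewrite !mxE !eqxx /= (eq_sym j) (negPf ij) sub0r (negPf lj) subr0.
  (* The entries compared are [-1] and 0 or 1; characteristic 0 separates [-1] from 1. *)
  by case: (l == i); rewrite ?oppr_eq0 ?oner_eq0 // eq_sym -subr_eq0 opprK -natrD Num.Theory.pnatr_eq0.
move=> k l; have -> : e k - e l = (-1) *: (e j - e k) + (e j - e l).
  by rewrite scaleN1r opprB addrA subrK.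
exact: Plin.
Qed.

(** * Common eigenvectors of a family of matrices stable under conjugation *)

Section CommonEigenvectors.
Variable Zs : seq 'M[F]_n.
Hypothesis Zs_conj : forall s A,
  A \in Zs -> perm_mx s *m A *m perm_mx s^-1 \in Zs.

Definition eigvec (chi : 'M[F]_n -> F) v := forall A, A \in Zs -> v *m A = chi A *: v.

Lemma eigvec_lin chi a u v : eigvec chi u -> eigvec chi v -> eigvec chi (a *: u + v).
Proof.
move=> eu ev A AZ; rewrite mulmxDl -scalemxAl eu // ev // scalerDr !scalerA.
by rewrite (mulrC a).
Qed.

Lemma eigvecZ chi a u : eigvec chi u -> eigvec chi (a *: u).
Proof. by move=> eu A AZ; rewrite -scalemxAl eu // !scalerA mulrC. Qed.

Lemma eigvec_eq chi psi u : {in Zs, chi =1 psi} -> eigvec chi u -> eigvec psi u.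
Proof. by move=> cp eu A AZ; rewrite eu // cp. Qed.

Definition conjchi (chi : 'M[F]_n -> F) s A := chi (perm_mx s *m A *m perm_mx s^-1).

Lemma eigvec_perm chi v s : eigvec chi v -> eigvec (conjchi chi s) (v *m perm_mx s).
Proof.
move=> ev A AZ; have := ev _ (Zs_conj s AZ).
move/(congr1 (fun w => w *m perm_mx s)); rewrite -scalemxAl => <-.
by rewrite !mulmxA mulmx_permVK.
Qed.

Lemma eigvec_permV chi v s : eigvec (conjchi chi s) v -> eigvec chi (v *m perm_mx s^-1).
Proof.
move=> ev A AZ; have := eigvec_perm s^-1 ev AZ; rewrite /conjchi invgK !mulmxA.
by rewrite !mulmx_permK -(perm_mxM _ s) mulgV perm_mx1 mul1mx.
Qed.

(** Applying [A - psi x A] kills the head term and scales [u] by a nonzero factor, which drives the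
    induction. The [psi x] may coincide; only [chi] has to differ from each. *)
Lemma eigvec_sum0 (T : eqType) (r : seq T) (psi : T -> 'M[F]_n -> F) (w : T -> 'rV[F]_n) chi u :
    eigvec chi u -> {in r, forall x, eigvec (psi x) (w x)} ->
    {in r, forall x, exists2 A, A \in Zs & chi A != psi x A} ->
  u = \sum_(x <- r) w x -> u = 0.
Proof.
elim: r w u => [|x r IH] w u eu ew npsi; first by rewrite big_nil.
rewrite big_cons => uE; have [|A AZ nA] := npsi x; first exact: mem_head.
have /eqP : (chi A - psi x A) *: u = 0.
  apply: (IH (fun y => (psi y A - psi x A) *: w y)).
  - exact: eigvecZ.
  - by move=> y yr; apply/eigvecZ/ew; rewrite in_cons yr orbT.
  - by move=> y yr; apply: npsi; rewrite in_cons yr orbT.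
  rewrite scalerBl -eu // {}uE mulmxDl scalerDr ew ?mem_head // opprD addrACA subrr add0r.
  rewrite mulmx_suml scaler_sumr -sumrB big_seq [RHS]big_seq.
  by apply: eq_bigr => y yr; rewrite ew ?in_cons ?yr ?orbT // scalerBl.
by rewrite scaler_eq0 subr_eq0 (negPf nA) => /eqP.
Qed.

Lemma eigvec_uniq0 chi psi u : eigvec chi u -> eigvec psi u ->
  (exists2 A, A \in Zs & chi A != psi A) -> u = 0.
Proof.
move=> eu pu np; apply: (@eigvec_sum0 _ [:: tt] (fun=> psi) (fun=> u) chi u) => //.
by rewrite big_seq1.
Qed.

(** A [chi]-eigenvector with equal entries at [k] and [l] is fixed by [tperm k l], hence also
    belongs to the moved character and vanishes. So [u 0 k - u 0 l] is injective on this
    eigenspace. *)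
Lemma eigvec_line chi v u k l : v != 0 -> eigvec chi v -> eigvec chi u ->
  (exists2 A, A \in Zs & conjchi chi (tperm k l) A != chi A) ->
  exists c, u = c *: v.
Proof.
move=> v0 ev eu nchi.
have fix0 w : eigvec chi w -> w 0 k = w 0 l -> w = 0.
  move=> ew wkl; have := tperm_subE w k l; rewrite wkl subrr scale0r => /eqP.
  rewrite subr_eq0 => /eqP wE; apply: (eigvec_uniq0 _ ew nchi).
  by rewrite wE; apply: eigvec_perm.
have vkl : v 0 k - v 0 l != 0.
  by rewrite subr_eq0; apply: contraNneq v0 => /(fix0 _ ev) ->.
exists ((u 0 k - u 0 l) / (v 0 k - v 0 l)); apply/eqP; rewrite -subr_eq0; apply/eqP.
apply: fix0; first by rewrite addrC -scaleNr; apply: eigvec_lin.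
by rewrite !mxE; field.
Qed.

Lemma eigvec_perm_line chi v u s k l : v != 0 -> eigvec chi v ->
    eigvec (conjchi chi s) u ->
    (exists2 A, A \in Zs & conjchi chi (tperm k l) A != chi A) ->
  exists c, u = c *: (v *m perm_mx s).
Proof.
move=> v0 ev /eigvec_permV eu /(eigvec_line v0 ev eu)[c uE]; exists c.
by rewrite scalemxAl -uE mulmx_permVK.
Qed.

(** If no summand has the character of [v *m perm_mx s], independence of characters makes this
    vector 0; if one does, the two share a one-dimensional eigenspace. *)
Lemma eigvec_rigid chi v k l : v != 0 -> eigvec chi v ->
  (exists2 A, A \in Zs & conjchi chi (tperm k l) A != chi A) -> perm_rigid v.
Proof.
move=> v0 ev nchi s r vE.
have [/hasP[x xr /allP eqx]|/hasPn nx] :=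
    boolP (has (fun x => all (fun A => conjchi chi s A == conjchi chi x.2 A) Zs) r).
  exists x => //; apply: (eigvec_perm_line v0 ev _ nchi).
  by apply: (eigvec_eq _ (eigvec_perm s ev)) => A /eqx/eqP.
have /(congr1 (mulmx^~ (perm_mx s^-1))) : v *m perm_mx s = 0.
  apply: (eigvec_sum0 (psi := fun x => conjchi chi x.2) (eigvec_perm s ev) _ _ vE).
    by move=> x _; apply/eigvecZ/eigvec_perm.
  by move=> x /nx /allPn.
by rewrite mulmx_permK mul0mx => v00; rewrite v00 eqxx in v0.
Qed.

(** If all transpositions preserve [chi], its eigenspace is a permutation-stable subspace; otherwise
    [v] is rigid and its shape is known. *)
Lemma eigvec_trichotomy chi v : (4 < n)%N -> v != 0 -> eigvec chi v ->
  [\/ exists g psi, (forall i, eigvec (psi i) (e i + const_mx g)) /\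
       (forall i j, i != j -> exists2 A, A \in Zs & psi i A != psi j A),
      exists a, v = const_mx a
    | forall k l, eigvec chi (e k - e l)].
Proof.
move=> n5 v0 ev.
have [nc|/forallPn[p /forallPn[q /allPn nchi]]] := boolP [forall p, forall q,
    all (fun A => conjchi chi (tperm p q) A == chi A) Zs].
  have [/existsP[i /existsP[j vij]]|/existsPn vc] :=
    boolP [exists i, exists j, v 0 i != v 0 j]; last first.
    have [l _] : exists l, l \notin [::] by apply: (@fresh_ord [::]); apply: leq_trans n5.
    constructor 2; exists (v 0 l); apply/rowP => k; rewrite mxE.
    by have /existsPn/(_ l) := vc k; rewrite negbK => /eqP.
  constructor 3; apply: (perm_stable_subspace _ _ ev vij); first exact: eigvec_lin.
  move=> p q u eu; apply: (eigvec_eq _ (eigvec_perm _ eu)) => A AZ.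
  by move/forallP/(_ p)/forallP/(_ q)/allP/(_ A AZ)/eqP: nc.
have rv := eigvec_rigid v0 ev nchi.
have [|[i [a [b [b0 vE]]]]] := perm_rigid_shape n5 rv; first by constructor 2.
constructor 1; exists (a / b), (fun j => conjchi chi (tperm i j)).
have ve j : e j + const_mx (a / b) = b^-1 *: (v *m perm_mx (tperm i j)).
  apply/rowP => k; rewrite [RHS]mxE mulmx_tpermE vE !mxE !eqxx /=.
  have -> : (tperm i j k == i) = (k == j).
    by rewrite -(inj_eq (@perm_inj _ (tperm i j))) tpermK tpermL.
  by case: (k == j); field.
have ej j : eigvec (conjchi chi (tperm i j)) (e j + const_mx (a / b)).
  by rewrite ve; apply/eigvecZ/eigvec_perm.
(* Equal characters at [j] and [k] would make the two shifted basis vectors proportional; their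
   entries at [j], [k] and a third index exclude this. *)
split=> // j k jk; apply/allPn/negP => /allP eqx.
have /(eigvec_perm_line v0 ev)/(_ nchi)[c] : eigvec (conjchi chi (tperm i k)) (e j + const_mx (a / b)).
  by apply: (eigvec_eq _ (ej j)) => A /eqx/eqP.
have /(congr1 ( *:%R b)) := ve k; rewrite scalerA divff // scale1r => <-.
rewrite scalerA => cE; pose g := a / b.
have [l] : exists l, l \notin [:: j; k] by apply: fresh_ord; apply: leq_trans n5.
rewrite !inE !negb_or => /andP[/negPf lj /negPf lk].
move: (congr1 (fun w : 'rV_n => w 0 k) cE) (congr1 (fun w : 'rV_n => w 0 j) cE).
move: (congr1 (fun w : 'rV_n => w 0 l) cE).
rewrite !mxE !eqxx /= lj lk (negPf jk) (eq_sym k j) (negPf jk) !add0r -/g.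
have [->|g0] := eqVneq g 0; first by rewrite !addr0 !mulr0 mulr1 => _ _ /eqP; rewrite oner_eq0.
move/esym/(canRL (mulfK g0)); rewrite divff // => ->.
rewrite !mul1r => /esym/eqP; rewrite -subr_eq0 addrK => /eqP E _.
by move/eqP: E; rewrite oner_eq0.
Qed.

(** All entries of the sum of the [e i + const_mx g] equal [1 + n g]; were this 0, independence of
    eigenvectors with distinct characters would make one of them 0. *)
Lemma eigvec_basis_neq0 g psi : (1 < n)%N ->
    (forall i, eigvec (psi i) (e i + const_mx g)) ->
    (forall i j, i != j -> exists2 A, A \in Zs & psi i A != psi j A) ->
  1 + n%:R * g != 0.
Proof.
move=> n2 ee npsi; apply/negP => /eqP ng0.
pose i := Ordinal (ltnW n2); pose j := Ordinal n2.
have : e i + const_mx g = 0.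
  apply: (@eigvec_sum0 _ [seq k <- index_enum 'I_n | k != i] psi (fun k => - 1 *: (e k + const_mx g)) (psi i)) => //.
  - by move=> k _; apply: eigvecZ.
  - by move=> k; rewrite mem_filter => /andP[ki _]; apply: npsi; rewrite eq_sym.
  rewrite big_filter -scaler_sumr scaleN1r; apply/eqP; rewrite -addr_eq0.
  have <- : \sum_k (e k + const_mx g) = e i + const_mx g + \sum_(k | k != i) (e k + const_mx g).
    by rewrite (bigD1 i).
  apply/eqP/rowP => k; rewrite summxE !mxE; under eq_bigr do rewrite !mxE eqxx /=.
  rewrite big_split /= sumr_const card_ord -mulr_natl (bigD1 k) //= eqxx big1 ?addr0 //.
  by move=> l lk; rewrite eq_sym (negPf lk).
move/rowP => E; move: (E i) (E j); rewrite !mxE !eqxx /= add0r => E1 E2.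
by move/eqP: E1; rewrite E2 addr0 oner_eq0.
Qed.

End CommonEigenvectors.

End PermutationVectors.

Lemma mnm_neq0 n (m : 'X_{1..n}) : m != 0%MM -> exists i, m i != 0%N.
Proof.
move=> m0; apply/existsP; apply: contraNT m0 => /existsPn m0.
by apply/eqP/mnmP => i; apply/eqP; rewrite mnm0E -[_ == _]negbK.
Qed.

(** * Directional derivatives and homogeneous forms *)

Section DirectionalDerivatives.
Variables (F : numFieldType) (n : nat).
Implicit Types (f g p q : {mpoly F[n]}) (u v w : 'rV[F]_n) (l : 'cV[F]_n).
Implicit Types (s : 'S_n) (A B : 'M[F]_n) (d k : nat).

Local Notation e i := (delta_mx 0 i : 'rV[F]_n).

Lemma mderivXU i j : ('X_j : {mpoly F[n]})^`M(i) = (i == j)%:R.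
Proof.
rewrite mderivX mnm1E eq_sym; case: eqVneq => [->|_]; last by rewrite scale0r.
by rewrite scale1r -[X in (X - _)%MM]add0m addmK mpolyX0.
Qed.

(** Both sides are derivations along [phi] that kill constants and agree on the variables. The
    instance needed is the derivative of a polynomial restricted to a line. *)
Lemma mderiv_chain (S : comNzRingType) (D : S -> S) (phi : {rmorphism {mpoly F[n]} -> S}) p :
    {morph D : x y / x + y} -> (forall x y, D (x * y) = D x * y + x * D y) ->
    (forall c, D (phi c%:MP) = 0) ->
  D (phi p) = \sum_i phi p^`M(i) * D (phi 'X_i).
Proof.
move=> DD DM D0; pose P q := D (phi q) = \sum_i phi q^`M(i) * D (phi 'X_i).
have PC c : P c%:MP.
  by rewrite /P D0 big1 // => i _; rewrite mderivC rmorph0 mul0r.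
have PM q1 q2 : P q1 -> P q2 -> P (q1 * q2).
  rewrite /P rmorphM DM => -> ->; rewrite mulr_suml mulr_sumr -big_split /=.
  by apply: eq_bigr => i _; rewrite mderivM rmorphD !rmorphM; ring.
have PX j : P 'X_j.
  rewrite /P (bigD1 j) //= big1 ?addr0 => [|i ij]; rewrite mderivXU.
    by rewrite eqxx rmorph1 mul1r.
  by rewrite (negPf ij) rmorph0 mul0r.
rewrite -/(P p); elim/mpolyind: p => [|c m q _ _ Pq]; first exact: (PC 0).
rewrite /P rmorphD DD Pq -[D (phi (_ *: _))]/(D (phi (c *: 'X_[m]))).
suff -> : P (c *: 'X_[m]).
  by rewrite -big_split; apply: eq_bigr => i _; rewrite mderivD rmorphD mulrDl.
rewrite -mul_mpolyC; apply: (PM _ _ (PC c)); rewrite mpolyXE_id.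
apply: (big_ind P) => [|q1 q2|i _]; [exact: (PC 1) | exact: PM | ].
by elim: (m i) => [|k IH]; [exact: (PC 1) | rewrite exprS; apply: PM].
Qed.

Definition dirD v f : {mpoly F[n]} := \sum_i v 0 i *: f^`M(i).

Lemma dirD_is_linear v : linear (dirD v).
Proof.
move=> a p q; rewrite /dirD scaler_sumr -big_split; apply: eq_bigr => i _ /=.
by rewrite linearP scalerDr !scalerA mulrC.
Qed.
HB.instance Definition _ v :=
  GRing.isLinear.Build F {mpoly F[n]} {mpoly F[n]} _ (dirD v) (dirD_is_linear v).

Definition dirDl f v := dirD v f.

Lemma dirDl_is_linear f : linear (dirDl f).
Proof.
move=> a u v; rewrite /dirDl /dirD scaler_sumr -big_split; apply: eq_bigr => i _ /=.
by rewrite !mxE scalerDl scalerA.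
Qed.
HB.instance Definition _ f :=
  GRing.isLinear.Build F 'rV[F]_n {mpoly F[n]} _ (dirDl f) (dirDl_is_linear f).

Lemma dirDDl f u v : dirD (u + v) f = dirD u f + dirD v f.
Proof. exact: (raddfD (dirDl f)). Qed.
Lemma dirDBl f u v : dirD (u - v) f = dirD u f - dirD v f.
Proof. exact: (raddfB (dirDl f)). Qed.
Lemma dirDZl f a v : dirD (a *: v) f = a *: dirD v f.
Proof. exact: (linearZ_LR (dirDl f)). Qed.
Lemma dirD0l f : dirD 0 f = 0.
Proof. exact: (raddf0 (dirDl f)). Qed.
Lemma dirD_suml (I : Type) (r : seq I) (P : pred I) (G : I -> 'rV[F]_n) f :
  dirD (\sum_(i <- r | P i) G i) f = \sum_(i <- r | P i) dirD (G i) f.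
Proof. exact: (raddf_sum (dirDl f)). Qed.

Lemma dirDDr v p q : dirD v (p + q) = dirD v p + dirD v q.
Proof. exact: (raddfD (dirD v)). Qed.
Lemma dirDBr v p q : dirD v (p - q) = dirD v p - dirD v q.
Proof. exact: (raddfB (dirD v)). Qed.
Lemma dirDZr a v p : dirD v (a *: p) = a *: dirD v p.
Proof. exact: (linearZ_LR (dirD v)). Qed.
Lemma dirD0r v : dirD v 0 = 0.
Proof. exact: (raddf0 (dirD v)). Qed.

Lemma dirD_sumr (I : Type) (r : seq I) (P : pred I) (G : I -> {mpoly F[n]}) v :
  dirD v (\sum_(i <- r | P i) G i) = \sum_(i <- r | P i) dirD v (G i).
Proof. exact: (raddf_sum (dirD v)). Qed.

Lemma dirD_delta f i : dirD (e i) f = f^`M(i).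
Proof.
rewrite /dirD (bigD1 i) //= mxE !eqxx scale1r big1 ?addr0 // => j ji.
by rewrite mxE (negPf ji) andbF scale0r.
Qed.

Lemma dirDC u v f : dirD u (dirD v f) = dirD v (dirD u f).
Proof.
have E u1 u2 : dirD u1 (dirD u2 f) = \sum_i \sum_j (u1 0 i * u2 0 j) *: f^`M(j)^`M(i).
  apply: eq_bigr => i _; rewrite (raddf_sum (mderiv i)) scaler_sumr.
  by apply: eq_bigr => j _; rewrite /= mderivZ scalerA.
rewrite !E exchange_big; apply: eq_bigr => i _; apply: eq_bigr => j _ /=.
by rewrite mulrC mderiv_comm.
Qed.

Lemma dirDM v p q : dirD v (p * q) = dirD v p * q + p * dirD v q.
Proof.
rewrite /dirD mulr_suml mulr_sumr -big_split; apply: eq_bigr => i _ /=.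
by rewrite mderivM scalerDr scalerAl scalerAr.
Qed.

Lemma dirD_mulmx v A f : dirD (v *m A) f = \sum_i v 0 i *: dirD (row i A) f.
Proof.
by rewrite mulmx_sum_row dirD_suml; apply: eq_bigr => i _; rewrite dirDZl.
Qed.

Lemma pairD v w l : ((v + w) *m l) 0 0 = (v *m l) 0 0 + (w *m l) 0 0.
Proof. by rewrite mulmxDl [LHS]mxE. Qed.
Lemma pairB v w l : ((v - w) *m l) 0 0 = (v *m l) 0 0 - (w *m l) 0 0.
Proof. by rewrite mulmxBl [LHS]mxE [X in _ + X]mxE. Qed.
Lemma pairZ a v l : ((a *: v) *m l) 0 0 = a * (v *m l) 0 0.
Proof. by rewrite -scalemxAl [LHS]mxE. Qed.
Lemma pair1 v : (v *m (const_mx 1 : 'cV[F]_n)) 0 0 = \sum_i v 0 i.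
Proof. by rewrite mxE; apply: eq_bigr => i _; rewrite mxE mulr1. Qed.

Definition linform l : {mpoly F[n]} := \sum_i l i 0 *: 'X_i.

Lemma dirD_linform v l : dirD v (linform l) = ((v *m l) 0 0)%:MP.
Proof.
rewrite (raddf_sum (dirD v)) mxE rmorph_sum; apply: eq_bigr => j _ /=.
rewrite linearZ /= /dirD (bigD1 j) //= mderivXU eqxx big1 ?addr0 => [|i ij].
  by rewrite scalerA -mul_mpolyC mulr1 mulrC.
by rewrite mderivXU (negPf ij) scaler0.
Qed.

Lemma dirD_exp v p k : dirD v (p ^+ k.+1) = k.+1%:R *: (p ^+ k * dirD v p).
Proof.
elim: k => [|k IH]; first by rewrite expr1 expr0 mul1r scale1r.
rewrite exprS dirDM IH -scalerAr mulrA -exprS.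
by rewrite (mulrC (dirD v p)) !scaler_nat [RHS]mulrS.
Qed.

Lemma dirD_linform_exp v l k : dirD v (linform l ^+ k.+1) =
  (k.+1%:R * (v *m l) 0 0) *: linform l ^+ k.
Proof. by rewrite dirD_exp dirD_linform mulrC mul_mpolyC scalerA. Qed.

Lemma dhomog_mderiv i f d : f \is d.+1.-homog -> f^`M(i) \is d.-homog.
Proof.
move=> hf; apply/dhomogP => m; rewrite mcoeff_msupp mcoeff_mderiv => nz.
apply/eqP; rewrite -eqSS -addn1 -(mdeg1 i) -mdegD; apply: contraNT nz => nd.
by rewrite (dhomog_nemf_coeff hf nd) mul0rn.
Qed.

Lemma dhomog_dirD v f d : f \is d.+1.-homog -> dirD v f \is d.-homog.
Proof. by move=> hf; apply: rpred_sum => i _; apply/rpredZ/dhomog_mderiv. Qed.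

(** Differentiating along a variable of a monomial multiplies its coefficient by a positive integer,
    and positive degree excludes constants. Equalities of forms below are tested on derivatives in
    this way. *)
Lemma homog_mderiv_eq0 f d : f \is d.+1.-homog -> (forall i, f^`M(i) = 0) -> f = 0.
Proof.
move=> hf df; apply/mpolyP => m; rewrite mcoeff0.
have [->|] := eqVneq m 0%MM; first by rewrite (dhomog_nemf_coeff hf) //= mdeg0.
move/mnm_neq0 => [i mi].
have /(congr1 (mcoeff (m - U_(i))%MM)) := df i.
rewrite mcoeff_mderiv submK; last by rewrite lep1mP.
rewrite mcoeff0 => /eqP; rewrite -mulr_natr mulf_eq0 Num.Theory.pnatr_eq0 orbF.
by move/eqP.
Qed.

Lemma homog_dirD_eq0 f d : f \is d.+1.-homog -> (forall v, dirD v f = 0) -> f = 0.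
Proof. by move=> hf df; apply: (homog_mderiv_eq0 hf) => i; rewrite -dirD_delta df. Qed.

Lemma linform_homog l k : linform l ^+ k \is k.-homog.
Proof.
rewrite -[k in k.-homog]mul1n; apply: dhomogMn; apply: rpred_sum => i _.
by apply: rpredZ; rewrite dhomogX /= mdeg1.
Qed.

(** Such a form depends on [linform l] alone: by induction [dirD u g] is a multiple of the next
    lower power, and integrating divides by the exponent. *)
Lemma homog_kernel_power g k l u : g \is k.-homog -> (u *m l) 0 0 = 1 ->
    (forall v, (v *m l) 0 0 = 0 -> dirD v g = 0) ->
  exists a, g = a *: linform l ^+ k.
Proof.
elim: k g => [|k IH] g hg ul dg.
  exists g@_0; apply/mpolyP => m; rewrite expr0 mcoeffZ mcoeff1.
  have [->|m0] := eqVneq m 0%MM; first by rewrite mulr1.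
  by rewrite (dhomog_nemf_coeff hg) ?mdeg_eq0 // mulr0.
have [|//|v vl|a uE] := IH (dirD u g).
- exact: dhomog_dirD.
- by rewrite dirDC dg ?dirD0r.
exists (a / k.+1%:R); apply/eqP; rewrite -subr_eq0; apply/eqP.
apply: (@homog_dirD_eq0 _ k) => [|v]; first by rewrite rpredB ?rpredZ ?linform_homog.
have vg : dirD v g = ((v *m l) 0 0 * a) *: linform l ^+ k.
  have {1}-> : v = (v *m l) 0 0 *: u + (v - (v *m l) 0 0 *: u) by rewrite addrC subrK.
  rewrite dirDDl dirDZl uE [dirD (v - _) g]dg ?addr0 ?scalerA //.
  by rewrite pairB pairZ ul mulr1 subrr.
rewrite dirDBr vg dirDZr dirD_linform_exp scalerA.
by rewrite mulrA divfK ?Num.Theory.pnatr_eq0 // mulrC subrr.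
Qed.

Lemma msym_dirD v s f : dirD v (msym s f) = msym s (dirD (v *m perm_mx s^-1) f).
Proof.
rewrite /dirD (raddf_sum (msym s)) (reindex_inj (@perm_inj _ s)); apply: eq_bigr => i _ /=.
rewrite msymZ mulmx_permE invgK; congr (_ *: _); apply/mpolyP => m.
rewrite mcoeff_mderiv !mcoeff_sym mcoeff_mderiv mnmE; congr (f@_ _ *+ _).
by apply/mnmP => j; rewrite !(mnmE, mnm1E) (inj_eq (@perm_inj _ s)).
Qed.

Lemma msym_homog s f d : f \is d.-homog -> msym s f \is d.-homog.
Proof.
move=> hf; apply/dhomogP => m; rewrite mcoeff_msupp mcoeff_sym; apply: contraNeq => nd.
by rewrite (dhomog_nemf_coeff hf) //= mdeg_mperm.
Qed.

End DirectionalDerivatives.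

(** * The commuting matrices that are self-adjoint for the Hessian *)

Section Center.
Variables (F : numFieldType) (n d : nat).
Variable f : {mpoly F[n]}.
Hypotheses (n_ge5 : (4 < n)%N) (f_homog : f \is d.+3.-homog).
Hypothesis f_concise : forall v : 'rV[F]_n, dirD v f = 0 -> v = 0.
Implicit Types (g p q : {mpoly F[n]}) (u v w : 'rV[F]_n).
Implicit Types (s : 'S_n) (A B : 'M[F]_n).

Local Notation e i := (delta_mx 0 i : 'rV[F]_n).
Local Notation t := (const_mx 1 : 'rV[F]_n).

(** The centre of the form [f]: matrices self-adjoint for its polynomial-valued Hessian. *)
Definition hess_sym A := forall v w,
  dirD (v *m A) (dirD w f) = dirD v (dirD (w *m A) f).

Lemma dirD2_eq0 v : (forall w, dirD w (dirD v f) = 0) -> v = 0.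
Proof.
move=> dv; apply/f_concise/homog_dirD_eq0/dv.
exact: dhomog_dirD f_homog.
Qed.

Lemma dirD3_eq0 v : (forall w x, dirD w (dirD x (dirD v f)) = 0) -> v = 0.
Proof.
move=> dv; apply: dirD2_eq0 => x; apply: homog_dirD_eq0 (dv^~ x).
exact/dhomog_dirD/dhomog_dirD/f_homog.
Qed.

(** A self-adjoint matrix moves freely between the slots of the symmetric trilinear map of third
    derivatives. Moving [A] to the second slot and [B] to the third gives the same value for both
    products. *)
Lemma hess_sym_comm A B : hess_sym A -> hess_sym B -> A *m B = B *m A.
Proof.
have [T TE] : exists T, forall u v w, T u v w = dirD u (dirD v (dirD w f)).
  by exists (fun u v w => dirD u (dirD v (dirD w f))).
have T12 u v w : T u v w = T v u w by rewrite !TE (dirDC u v).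
have T23 u v w : T u v w = T u w v by rewrite !TE (dirDC v w).
have sT12 D u v w : hess_sym D -> T (u *m D) v w = T u (v *m D) w.
  by move=> hD; rewrite T23 T12 [RHS]T23 [RHS]T12 !TE hD.
have sT13 D u v w : hess_sym D -> T (u *m D) v w = T u v (w *m D).
  by move=> hD; rewrite T23 (sT12 _ _ _ _ hD) T23.
move=> hA hB; apply/row_matrixP => i; rewrite !rowE; apply/eqP; rewrite -subr_eq0.
apply/eqP/dirD3_eq0 => w x; rewrite dirDBl !dirDBr.
have E D : dirD w (dirD x (dirD (e i *m D) f)) = T (e i *m D) x w.
  by rewrite T12 T23 T12 TE.
rewrite (E (A *m B)) (E (B *m A)) (mulmxA _ A) (mulmxA _ B).
rewrite (sT13 _ _ _ _ hB) (sT12 _ _ _ _ hA) (sT12 _ _ _ _ hA) (sT13 _ _ _ _ hB).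
by rewrite subrr.
Qed.

Lemma hess_sym_lin a A B : hess_sym A -> hess_sym B -> hess_sym (a *: A + B).
Proof.
move=> hA hB v w; rewrite !mulmxDr -!scalemxAr !dirDDl !dirDZl hA hB.
by rewrite dirDDr dirDZr.
Qed.

Lemma hess_sym_scalar a : hess_sym a%:M.
Proof.
by move=> v w; rewrite !mul_mx_scalar !dirDZl dirDZr.
Qed.

Variable M : 'S_n -> 'M[F]_n.
Hypothesis M_jac : forall s v, dirD v (msym s f) = dirD (v *m M s) f.

(** Both sides equal the second derivative of [msym s f] along [v] and [w]. *)
Lemma hess_sym_jac s : hess_sym (M s).
Proof. by move=> v w; rewrite -M_jac dirDC -M_jac dirDC. Qed.

(** Since [B] commutes with [M s], it is also self-adjoint for [msym s f]; transporting this back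
    along [s] conjugates [B]. *)
Lemma hess_sym_conj s B : hess_sym B -> hess_sym (perm_mx s *m B *m perm_mx s^-1).
Proof.
move=> hB.
have hsB v w : dirD (v *m B) (dirD w (msym s f)) = dirD v (dirD (w *m B) (msym s f)).
  rewrite !M_jac hB -(mulmxA w) (hess_sym_comm (hess_sym_jac s) hB).
  by rewrite mulmxA.
move=> v w; apply: (@inj_msym _ _ s).
have := hsB (v *m perm_mx s) (w *m perm_mx s); rewrite !msym_dirD !mulmx_permK.
by rewrite !mulmxA.
Qed.

Definition conj_jac : seq 'M[F]_n :=
  [seq perm_mx s *m M r *m perm_mx s^-1 | s <- enum 'S_n, r <- enum 'S_n].

Lemma hess_sym_conj_jac A : A \in conj_jac -> hess_sym A.
Proof. by case/allpairsP => x [_ _ ->]; apply/hess_sym_conj/hess_sym_jac. Qed.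

Lemma jac_mem_conj s : M s \in conj_jac.
Proof.
apply/allpairsP; exists (1%g, s); split; rewrite ?mem_enum //=.
by rewrite invg1 perm_mx1 mul1mx mulmx1.
Qed.

Lemma conj_jac_conj s A : A \in conj_jac -> perm_mx s *m A *m perm_mx s^-1 \in conj_jac.
Proof.
case/allpairsP => -[r x] [/= _ _ ->]; apply/allpairsP; exists (s * r, x)%g.
split; rewrite ?mem_enum //= invMg (perm_mxM _ s) (perm_mxM _ r^-1%g).
by rewrite !mulmxA.
Qed.

Lemma mulmx_const1_row (w : 'rV[F]_n) (a : 'cV[F]_n) i : e i *m (a *m w) = a i 0 *: w.
Proof. by apply/rowP => k; rewrite -rowE !mxE big_ord1 ?mxE. Qed.

Lemma sum0_span v k : \sum_i v 0 i = 0 -> v = \sum_i v 0 i *: (e i - e k).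
Proof.
move=> v0; under eq_bigr do rewrite scalerBr.
by rewrite sumrB -row_sum_delta -scaler_suml v0 scale0r subr0.
Qed.

Lemma dirD_sum0 v g : \sum_i v 0 i = 0 -> (forall i j, dirD (e i - e j) g = 0) ->
  dirD v g = 0.
Proof.
move=> v0 dg; rewrite (sum0_span (Ordinal (ltnW n_ge5)) v0) dirD_suml big1 // => i _.
by rewrite dirDZl dg scaler0.
Qed.

(** Otherwise all derivatives along zero-sum directions would be multiples of one power of the
    coordinate sum, and a combination of two independent such directions would kill [f]. *)
Lemma hess_sum0_neq0 :
  ~ (forall i j k l, dirD (e i - e j) (dirD (e k - e l) f) = 0).
Proof.
move=> df.
have pow k l : exists a, dirD (e k - e l) f = a *: linform (const_mx 1 : 'cV[F]_n) ^+ d.+2.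
  apply: (homog_kernel_power (u := e k)).
  - exact: dhomog_dirD f_homog.
  - rewrite pair1 (bigD1 k) //= mxE !eqxx big1 ?addr0 // => i ik.
    by rewrite mxE (negPf ik) andbF.
  by move=> v; rewrite pair1 => v0; apply: dirD_sum0.
pose i0 : 'I_n := Ordinal (ltnW (ltnW (ltnW (ltnW n_ge5)))).
pose i1 : 'I_n := Ordinal (ltnW (ltnW (ltnW n_ge5))).
pose i2 : 'I_n := Ordinal (ltnW (ltnW n_ge5)).
have [a aE] := pow i0 i1; have [b bE] := pow i0 i2.
have /f_concise/rowP E : dirD (b *: (e i0 - e i1) - a *: (e i0 - e i2)) f = 0.
  by rewrite dirDBl !dirDZl aE bE !scalerA mulrC subrr.
have := E i2; rewrite !mxE /= !subr0 mulr0 !sub0r mulrN1 opprK => a0.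
have /f_concise/rowP/(_ i0) : dirD (e i0 - e i1) f = 0 by rewrite aE a0 scale0r.
by rewrite !mxE /= subr0 => /eqP; rewrite oner_eq0.
Qed.

(** The [u] with this property form a permutation-stable subspace. Were all [v = e k - e l] in it,
    then, as [const_mx 1 *m v] sends every [e p] to [v], all second derivatives along zero-sum
    directions would vanish. *)
Lemma hess_sym_rows u : hess_sym ((const_mx 1 : 'cV_n) *m u) -> forall i j, u 0 i = u 0 j.
Proof.
move=> hu i j; apply/eqP/negPn/negP => uij; apply: hess_sum0_neq0.
pose P v := hess_sym ((const_mx 1 : 'cV_n) *m v).
move=> k l p q; suff hP : P (e k - e l).
  have := hP (e p) (e q); rewrite !mulmx_const1_row !mxE !scale1r dirDC => E.
  by rewrite dirDC dirDBl E subrr.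
apply: (perm_stable_subspace (P := P) _ _ hu uij).
  by move=> a v w hv hw; rewrite /P mulmxDr -scalemxAr; apply: hess_sym_lin.
move=> x y v hv; rewrite /P; have -> : (const_mx 1 : 'cV[F]_n) *m (v *m perm_mx (tperm x y)) =
    perm_mx (tperm x y) *m (const_mx 1 *m v) *m perm_mx (tperm x y)^-1.
  rewrite tpermV !mulmxA -row_permE; congr (_ *m _ *m _).
  by apply/colP => z; rewrite !mxE.
exact: hess_sym_conj.
Qed.

(** Dually, a nonconstant [u] would make every [(e k - e l)^T *m t] self-adjoint. For [q] other than
    [k] and [l] it sends [e k] to [t] and [e q] to 0, so [dirD t f] would have zero derivatives. *)
Lemma hess_sym_cols (u : 'cV[F]_n) : hess_sym (u *m t) -> forall i j, u i 0 = u j 0.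
Proof.
move=> hu i j; apply/eqP/negPn/negP => uij.
pose P (v : 'rV[F]_n) := hess_sym (v^T *m t).
have hP k l : P (e k - e l).
  apply: (perm_stable_subspace (P := P) (u := u^T) (i := i) (j := j)).
  - by move=> a v w hv hw; rewrite /P linearP mulmxDl -scalemxAl; apply: hess_sym_lin.
  - move=> x y v hv; rewrite /P; have -> : (v *m perm_mx (tperm x y))^T *m t =
        perm_mx (tperm x y) *m (v^T *m t) *m perm_mx (tperm x y)^-1.
      rewrite trmx_mul tr_perm_mx -!mulmxA -col_permE tpermV.
      by congr (_ *m (_ *m _)); apply/rowP => z; rewrite !mxE.
    exact: hess_sym_conj.
  - by rewrite /P trmxK.
  by rewrite !mxE.
suff /f_concise/rowP/(_ i) : dirD t f = 0.
  by rewrite !mxE => /eqP; rewrite oner_eq0.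
apply: homog_mderiv_eq0 (dhomog_dirD t f_homog) _ => q; rewrite -dirD_delta.
have [k] : exists k, k \notin [:: q] by apply: fresh_ord; apply: leq_trans n_ge5.
rewrite inE => kq.
have [l] : exists l, l \notin [:: q; k] by apply: fresh_ord; apply: leq_trans n_ge5.
rewrite !inE negb_or => /andP[lq lk].
have := hP k l (e k) (e q); rewrite !mulmx_const1_row !mxE !eqxx /=.
rewrite (eq_sym k) (negPf lk) !(eq_sym q) (negPf kq) (negPf lq) !subr0.
by rewrite scale1r scale0r dirD0l dirD0r dirDC.
Qed.
End Center.

(** * Common eigenvectors inside an invariant subspace *)

Section CommonEigenvectorIn.
Variables (F : numClosedFieldType) (n : nat).

Lemma common_eigenvector_in (V : 'M[F]_n) (As : seq 'M[F]_n) : V != 0 ->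
    {in As, forall A, stablemx V A} -> {in As &, forall A B, comm_mx A B} ->
  exists2 v : 'rV[F]_n, v != 0 & (v <= V)%MS /\ {in As, forall A, stablemx v A}.
Proof.
move=> V0 VA comA.
have [||v v0 /allP vA] := @common_eigenvector _ _ [seq restrictmx V A | A <- As].
- by rewrite lt0n mxrank_eq0.
- move=> _ _ /mapP[A hA ->] /mapP[B hB ->]; rewrite /comm_mx.
  by rewrite -!conjmxM ?inE ?stablemx_row_base ?VA // comA.
exists (v *m row_base V); first by rewrite mulmx_free_eq0 ?row_base_free.
split; first by rewrite mulmx_sub // eq_row_base.
by move=> A hA; rewrite -stablemx_restrict ?VA // vA //; apply/mapP; exists A.
Qed.

Lemma stable_eigvec (v : 'rV[F]_n) (As : seq 'M[F]_n) : v != 0 ->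
  {in As, forall A, stablemx v A} -> exists chi, eigvec As chi v.
Proof.
case/rV0Pn => i vi vA; exists (fun A => (v *m A) 0 i / v 0 i) => A /vA /sub_rVP[a aE].
by rewrite aE mxE mulfK.
Qed.

End CommonEigenvectorIn.

(** * Shape of the Jacobian matrices of a concise form *)

Section Classification.
Variables (F : numClosedFieldType) (n d : nat) (f : {mpoly F[n]}).
Hypotheses (n_ge5 : (4 < n)%N) (f_homog : f \is d.+3.-homog).
Hypothesis f_concise : forall v : 'rV[F]_n, dirD v f = 0 -> v = 0.
Variable M : 'S_n -> 'M[F]_n.
Hypothesis M_jac : forall s v, dirD v (msym s f) = dirD (v *m M s) f.

Local Notation e i := (delta_mx 0 i : 'rV[F]_n).
Local Notation t := (const_mx 1 : 'rV[F]_n).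
Local Notation Zs := (conj_jac M).

Let symZ A : A \in Zs -> hess_sym f A.
Proof. exact: (hess_sym_conj_jac f_homog f_concise M_jac). Qed.

Let comZ : {in Zs &, forall A B, comm_mx A B}.
Proof. by move=> A B /symZ hA /symZ hB; apply: (hess_sym_comm f_homog f_concise hA hB). Qed.

Lemma conj_jac_tr s A : A \in [seq B^T | B <- Zs] ->
  perm_mx s *m A *m perm_mx s^-1 \in [seq B^T | B <- Zs].
Proof.
case/mapP => B BZ ->; apply/mapP; exists (perm_mx s *m B *m perm_mx s^-1).
  exact: conj_jac_conj.
by rewrite !trmx_mul !tr_perm_mx invgK mulmxA.
Qed.

(** As [t] is a common eigenvector, the zero-sum covectors are stable under the transposes and
    contain a common eigenvector. Only the third case of the trichotomy is then possible. *)
Lemma hess_class_cols :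
    (exists chi, eigvec Zs chi t) ->
  {in Zs, forall A, exists chi c, A = chi%:M + c *: const_mx 1}.
Proof.
case=> chi et.
have n0 : n%:R != 0 :> F by rewrite Num.Theory.pnatr_eq0 -lt0n; apply: leq_trans n_ge5.
have [|_ /mapP[A AZ ->]|_ _ /mapP[A AZ ->] /mapP[B BZ ->]|v v0 [vK vA]] :=
    @common_eigenvector_in _ _ (kermx (const_mx 1 : 'cV[F]_n)) [seq B^T | B <- Zs].
- apply/negP => /eqP K0; have := mxrank_ker (const_mx 1 : 'cV[F]_n).
  rewrite K0 mxrank0 => /esym/eqP; rewrite subn_eq0 leqNgt => /negP; apply.
  by apply: leq_ltn_trans (rank_leq_col _) _; apply: leq_trans n_ge5.
- apply/sub_kermxP; rewrite -mulmxA.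
  have -> : A^T *m (const_mx 1 : 'cV[F]_n) = chi A *: const_mx 1.
    by rewrite -[const_mx 1 in LHS]trmxK -trmx_mul trmx_const et // linearZ /= trmx_const.
  by rewrite -scalemxAr mulmx_ker scaler0.
- by rewrite /comm_mx -!trmx_mul comZ.
have [psi ev] := stable_eigvec v0 vA.
case: (eigvec_trichotomy conj_jac_tr n_ge5 v0 ev) => [[g [ph [eg npsi]]]|[a vE]|eH].
- have g0 : 1 + n%:R * g != 0.
    by apply: (eigvec_basis_neq0 _ eg npsi); apply: leq_trans n_ge5.
  have tw i : (t *m (e i + const_mx g)^T) 0 0 = 1 + n%:R * g.
    rewrite mxE; under eq_bigr do rewrite !mxE mul1r eqxx /=.
    rewrite big_split /= sumr_const card_ord -[g *+ n]mulr_natl (bigD1 i) //= eqxx big1 ?addr0 //.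
    by move=> l /negPf->.
  (* Each covector [e i + const_mx g] has a nonzero pairing with [t], so its character must be that
     of [t], against distinctness. *)
  have E i A : A \in Zs -> ph i A^T = chi A.
    move=> AZ; have /(congr1 trmx) := eg i A^T (map_f _ AZ).
    rewrite trmx_mul trmxK linearZ /= => /(congr1 (mulmx t)).
    rewrite mulmxA et // -scalemxAl -scalemxAr => /matrixP/(_ 0 0).
    by rewrite [LHS]mxE [RHS]mxE tw => /(mulIf g0).
  pose i0 : 'I_n := Ordinal (ltnW (ltnW (ltnW (ltnW n_ge5)))).
  pose i1 : 'I_n := Ordinal (ltnW (ltnW (ltnW n_ge5))).
  by have [//|_ /mapP[A AZ ->]] := npsi i0 i1; rewrite !E // eqxx.
- have /sub_kermxP/matrixP/(_ 0 0) := vK; rewrite vE !mxE.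
  under eq_bigr do rewrite !mxE mulr1.
  rewrite sumr_const card_ord -mulr_natr => /eqP; rewrite mulf_eq0 (negPf n0) orbF.
  by move=> /eqP a0; case/rV0Pn: v0 => i; rewrite vE mxE a0 eqxx.
pose k : 'I_n := Ordinal (ltnW (ltnW (ltnW (ltnW n_ge5)))).
(* All differences of basis covectors have the same eigenvalue, so the columns of [B] agree;
   [hess_sym_cols] makes the common column constant. *)
move=> A AZ; pose B := A - (psi A^T)%:M; pose u : 'cV[F]_n := col k B.
have BE : B = u *m t.
  apply/matrixP => i j; rewrite [RHS]mxE big_ord1 [t _ _]mxE mulr1 [RHS]mxE.
  have := eH j k _ (map_f _ AZ); rewrite mulmxBl -!rowE => /rowP/(_ i).
  rewrite !mxE eqxx /= -!(mulr_natr (psi _)) => E; apply/eqP; rewrite -subr_eq0; apply/eqP.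
  by rewrite -(subrK (A i k) (A i j)) E; ring.
have hB : hess_sym f (u *m t).
  have := hess_sym_lin (-1) (@hess_sym_scalar _ _ f (psi A^T)) (symZ AZ).
  by rewrite scaleN1r addrC -/B BE.
have uc := hess_sym_cols n_ge5 f_homog f_concise M_jac hB.
exists (psi A^T), (u k 0); rewrite -[LHS](subrK (psi A^T)%:M) -/B BE addrC.
by congr (_ + _); apply/matrixP => i j; rewrite [LHS]mxE big_ord1 (uc i k) [t _ _]mxE [RHS]mxE [X in _ = _ * X]mxE.
Qed.

Lemma hess_class :
  (exists g, 1 + n%:R * g != 0 /\ forall i j, i != j ->
     dirD (e i + const_mx g) (dirD (e j + const_mx g) f) = 0) \/
  {in Zs, forall A, exists chi c, A = chi%:M + c *: const_mx 1}.
Proof.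
have n_gt0 : (0 < n)%N by apply: leq_trans n_ge5.
have [v v0 /allP vA] := common_eigenvector n_gt0 comZ.
have [psi ev] := stable_eigvec v0 vA.
case: (eigvec_trichotomy (@conj_jac_conj _ _ M) n_ge5 v0 ev) => [[g [ph [eg npsi]]]|[a vE]|eH].
- left; exists g; split; first by apply: (eigvec_basis_neq0 _ eg npsi); apply: leq_trans n_ge5.
  (* Self-adjointness scales one second derivative by two distinct eigenvalues with equal
     results. *)
  move=> i j /npsi[A AZ nA]; have := symZ AZ (e i + const_mx g) (e j + const_mx g).
  rewrite !eg // !dirDZl dirDZr => /eqP; rewrite -subr_eq0 -scalerBl scaler_eq0.
  by rewrite subr_eq0 (negPf nA) => /eqP.
- right; apply: hess_class_cols; exists psi.
  have a0 : a != 0 by case/rV0Pn: v0 => i; rewrite vE mxE.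
  have -> : t = a^-1 *: v by rewrite vE; apply/rowP => i; rewrite !mxE mulVf.
  exact: eigvecZ.
right; pose k := Ordinal n_gt0.
(* Here the rows of [B] agree, and [hess_sym_rows] makes the common row constant. *)
move=> A AZ; pose B := A - (psi A)%:M; pose u : 'rV[F]_n := row k B.
have BE : B = (const_mx 1 : 'cV[F]_n) *m u.
  apply/matrixP => i j; rewrite [RHS]mxE big_ord1 [const_mx _ _ _]mxE mul1r [RHS]mxE.
  have := eH i k _ AZ; rewrite mulmxBl -!rowE => /rowP/(_ j).
  rewrite !mxE eqxx /= -!(mulr_natr (psi _)) => E; apply/eqP; rewrite -subr_eq0; apply/eqP.
  by rewrite -(subrK (A k j) (A i j)) E !(eq_sym j); ring.
have hB : hess_sym f ((const_mx 1 : 'cV[F]_n) *m u).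
  have := hess_sym_lin (-1) (@hess_sym_scalar _ _ f (psi A)) (symZ AZ).
  by rewrite scaleN1r addrC -/B BE.
have uc := hess_sym_rows n_ge5 f_homog f_concise M_jac hB.
exists (psi A), (u 0 k); rewrite -[LHS](subrK (psi A)%:M) -/B BE addrC.
by congr (_ + _); apply/matrixP => i j; rewrite [LHS]mxE big_ord1 (uc j k) [const_mx _ _ _]mxE [RHS]mxE [X in _ = _ * X]mxE mul1r mulr1.
Qed.

(** Self-adjointness of [M s] at [e i] and [e j] makes [c] times the given nonzero derivative
    vanish, so [M s] is scalar. *)
Lemma jac_scalar i j s : {in Zs, forall A, exists chi c, A = chi%:M + c *: const_mx 1} ->
  dirD t (dirD (e i - e j) f) <> 0 -> exists chi, msym s f = chi *: f.
Proof.
move=> ZE dt; have [chi [c ME]] := ZE _ (jac_mem_conj M s); exists chi.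
have c0 : c = 0.
  apply/eqP/negPn/negP => c0; apply: dt.
  have E : dirD t (dirD (e j) f) = dirD (e i) (dirD t f).
    have J k : e k *m const_mx 1 = t by apply/rowP => l; rewrite -rowE !mxE.
    have := symZ (jac_mem_conj M s) (e i) (e j); rewrite ME !mulmxDr !mul_mx_scalar.
    by rewrite -!scalemxAr !J !dirDDl !dirDZl dirDDr !dirDZr => /addrI/(scalerI c0).
  by rewrite dirDBl dirDBr E dirDC subrr.
apply/eqP; rewrite -subr_eq0; apply/eqP; apply: (@homog_dirD_eq0 _ _ _ d.+2).
  by rewrite rpredB ?rpredZ ?msym_homog.
move=> v; rewrite dirDBr dirDZr M_jac ME c0 scale0r addr0 mul_mx_scalar dirDZl.
by rewrite subrr.
Qed.

Lemma jac_formula s : {in Zs, forall A, exists chi c, A = chi%:M + c *: const_mx 1} ->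
  exists chi c, forall v, dirD v (msym s f) =
    chi *: dirD v f + (c * \sum_i v 0 i) *: dirD t f.
Proof.
move=> ZE; have [chi [c ME]] := ZE _ (jac_mem_conj M s); exists chi, c => v.
rewrite M_jac ME mulmxDr mul_mx_scalar -scalemxAr dirDDl !dirDZl -scalerA; congr (_ + _ *: _).
rewrite -dirDZl; congr (dirD _ _); apply/rowP => i; rewrite !mxE mulr1.
by apply: eq_bigr => j _; rewrite mxE mulr1.
Qed.
End Classification.

(** * The three families from conditions on derivatives *)

Section Families.
Variables (F : numFieldType) (n : nat).
Implicit Types (f h p q : {mpoly F[n]}) (u v w x : 'rV[F]_n) (s : 'S_n) (d k : nat).

Local Notation e i := (delta_mx 0 i : 'rV[F]_n).
Local Notation t := (const_mx 1 : 'rV[F]_n).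
Local Notation L := (linform (const_mx 1 : 'cV[F]_n)).
Local Notation l g i := ((e i + const_mx g)^T : 'cV[F]_n).

(** For nonzero [f] the scalars form a linear character of the symmetric group: its value on a
    transposition is 1 or -1, the same for all of them by conjugacy. *)
Lemma semi_invariant_cases f : (forall s, exists c, msym s f = c *: f) ->
  (forall s, msym s f = f) \/ (forall s, msym s f = (-1) ^+ s *: f).
Proof.
move=> sf; have [->|f0] := eqVneq f 0; first by left=> s; rewrite msym0.
have [/forallP fix_f|/forallPn[i /forallPn[j fij]]] :=
    boolP [forall i, forall j, msym (tperm i j) f == f].
  left=> s; have [ts -> _] := prod_tpermP s.
  elim: ts => [|x ts IH]; first by rewrite big_nil msym1m.
  by rewrite big_cons msymMm; have /forallP/(_ x.2)/eqP -> := fix_f x.1.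
right.
have ij : i != j.
  by apply: contraNneq fij => ->; rewrite tperm1 msym1m.
have fijN : msym (tperm i j) f = - f.
  have [c cE] := sf (tperm i j); rewrite cE.
  have /eqP : c *: (c *: f) = f by rewrite -{1}cE -msymZ -cE -msymMm tperm2 msym1m.
  rewrite -[X in _ == X]scale1r scalerA -subr_eq0 -scalerBl scaler_eq0 (negPf f0) orbF.
  rewrite subr_eq0 -expr2 sqrf_eq1 => /orP[] /eqP c1; last by rewrite c1 scaleN1r.
  by move: fij; rewrite cE c1 scale1r eqxx.
have fklN (k m : 'I_n) : k != m -> msym (tperm k m) f = - f.
  move=> km; have [s si sj] : exists2 s : 'S_n, s i = k & s j = m.
    exists (tperm i k * tperm (tperm i k j) m)%g; last by rewrite permM tpermL.
    rewrite permM tpermL tpermD //; last by rewrite eq_sym.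
    by rewrite -[X in _ != X](tpermL i k) (inj_eq (@perm_inj _ _)) eq_sym.
  have -> : tperm k m = (tperm i j ^ s)%g by rewrite tpermJ si sj.
  have [c cE] := sf s; have [b bE] := sf s^-1%g.
  rewrite conjgE !msymMm bE msymZ fijN msymZ msymN cE.
  rewrite scalerN scalerA; congr (- _).
  have : msym s (msym s^-1 f) = f by rewrite -msymMm mulVg msym1m.
  by rewrite bE msymZ cE scalerA.
move=> s; have [ts -> tsP] := prod_tpermP s.
elim: ts tsP => [|x ts IH] /=; first by rewrite big_nil msym1m odd_perm1 scale1r.
case/andP => x12 /IH{}IH; rewrite big_cons msymMm fklN // msymN IH.
by rewrite odd_permM odd_tperm x12 signr_addb expr1 mulN1r scaleNr.
Qed.

Lemma msym_linform s (c : 'cV[F]_n) :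
  msym s (linform c) = linform (\col_i c ((s^-1)%g i) 0).
Proof.
rewrite /linform (raddf_sum (msym s)) [RHS](reindex_inj (@perm_inj _ s)).
apply: eq_bigr => i _; rewrite /= msymZ mxE permK msymX; congr (_ *: 'X_[_]).
by apply/mnmP => j; rewrite mnmE !mnm1E -(inj_eq (@perm_inj _ s)) permKV.
Qed.

Lemma msym_linform1 s k : msym s (L ^+ k) = L ^+ k.
Proof.
rewrite rmorphXn /= msym_linform; congr (linform _ ^+ _).
by apply/colP => i; rewrite !mxE.
Qed.

Lemma linform_shift g i : linform (l g i) = 'X_i + g *: L.
Proof.
rewrite /linform scaler_sumr; under eq_bigr do rewrite !mxE eqxx scalerDl.
rewrite big_split /=; congr (_ + _); last by apply: eq_bigr => j _; rewrite mxE scalerA mulr1.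
rewrite (bigD1 i) //= eqxx scale1r big1 ?addr0 // => j /negPf->.
by rewrite scale0r.
Qed.

Lemma dirD_split_eq0 q : (0 < n)%N -> dirD t q = 0 ->
  (forall w, \sum_i w 0 i = 0 -> dirD w q = 0) -> forall w, dirD w q = 0.
Proof.
move=> n_gt0 tq wq w; have n0 : n%:R != 0 :> F by rewrite Num.Theory.pnatr_eq0 -lt0n.
pose c := (\sum_i w 0 i) / n%:R.
have -> : w = c *: t + (w - c *: t) by rewrite addrC subrK.
rewrite dirDDl dirDZl tq scaler0 add0r wq //.
under eq_bigr do rewrite !mxE mulr1.
by rewrite sumrB sumr_const card_ord -mulr_natr divfK // subrr.
Qed.

Lemma pair_t : (t *m (const_mx 1 : 'cV[F]_n)) 0 0 = n%:R.
Proof. by rewrite pair1; under eq_bigr do rewrite mxE; rewrite sumr_const card_ord. Qed.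

Lemma pair_e i : (e i *m (const_mx 1 : 'cV[F]_n)) 0 0 = 1.
Proof. by rewrite -rowE !mxE. Qed.

Lemma t_perm s : t *m perm_mx s = t.
Proof. by apply/rowP => i; rewrite mulmx_permE !mxE. Qed.

(** The first condition makes [dirD t f] a multiple of a power of [L]; subtracting its integral
    leaves [h]. Zero-sum directions do not see powers of [L], so along them the formula for
    [msym s f] passes to [h]. *)
Lemma split_of_jac d f : (0 < n)%N -> f \is d.+3.-homog ->
    (forall i j, dirD t (dirD (e i - e j) f) = 0) ->
    (forall s, exists chi c, forall v, dirD v (msym s f) =
       chi *: dirD v f + (c * \sum_i v 0 i) *: dirD t f) ->
  exists a h, [/\ h \is d.+3.-homog, dirD t h = 0,
    forall s, exists chi, msym s h = chi *: h & f = a *: L ^+ d.+3 + h].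
Proof.
move=> n_gt0 hf dtf sf; pose k := Ordinal n_gt0.
have n0 : n%:R != 0 :> F by rewrite Num.Theory.pnatr_eq0 -lt0n.
have d0 : d.+3%:R != 0 :> F by rewrite Num.Theory.pnatr_eq0.
have [v|b tf] := homog_kernel_power (dhomog_dirD t hf) (pair_e k).
  rewrite pair1 => /(sum0_span k)->; rewrite dirD_suml big1 // => i _.
  by rewrite dirDZl dirDC dtf scaler0.
pose a := b / (d.+3%:R * n%:R); pose h := f - a *: L ^+ d.+3.
have hh : h \is d.+3.-homog by rewrite rpredB ?rpredZ ?linform_homog.
have th : dirD t h = 0.
  rewrite dirDBr dirDZr dirD_linform_exp tf pair_t scalerA divfK ?mulf_neq0 //.
  by rewrite subrr.
exists a, h; split=> // [s|]; last by rewrite addrC subrK.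
have [chi [c sE]] := sf s; exists chi; apply/eqP; rewrite -subr_eq0; apply/eqP.
apply: (@homog_dirD_eq0 _ _ _ d.+2); first by rewrite rpredB ?rpredZ ?msym_homog.
apply: dirD_split_eq0 => // [|w w0]; rewrite dirDBr dirDZr.
  by rewrite msym_dirD t_perm th msym0 scaler0 subrr.
have wL x : \sum_i x 0 i = 0 -> dirD x (L ^+ d.+3) = 0.
  by move=> x0; rewrite dirD_linform_exp pair1 x0 mulr0 scale0r.
rewrite msymB dirDBr sE w0 mulr0 scale0r addr0 msymZ dirDZr msym_dirD wL; last first.
  rewrite -[RHS]w0 [RHS](reindex_inj (@perm_inj _ s)).
  by apply: eq_bigr => i _; rewrite mulmx_permE invgK.
by rewrite msym0 scaler0 subr0 dirDBr dirDZr wL // scaler0 subr0 subrr.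
Qed.

(** The parameter making the forms ['X_i + dual_shift g *: L] the basis dual to the vectors
    [e i + const_mx g]. *)
Definition dual_shift (g : F) := - (g / (1 + n%:R * g)).

Lemma dual_shift_neq0 g : 1 + n%:R * g != 0 -> 1 + n%:R * dual_shift g != 0.
Proof.
move=> g0; have -> : 1 + n%:R * dual_shift g = (1 + n%:R * g)^-1.
  by rewrite /dual_shift; field.
by rewrite invr_eq0.
Qed.

Lemma pair_shift w g i : (w *m l g i) 0 0 = w 0 i + g * \sum_j w 0 j.
Proof.
rewrite mxE; under eq_bigr do rewrite !mxE eqxx mulrDr.
rewrite big_split /= -mulr_suml mulrC; congr (_ + _).
rewrite (bigD1 i) //= eqxx mulr1 big1 ?addr0 // => j ji.
by rewrite (negPf ji) mulr0.
Qed.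

Lemma sum_shift g i : \sum_j (e i + const_mx g : 'rV[F]_n) 0 j = 1 + n%:R * g.
Proof.
under eq_bigr do rewrite !mxE eqxx.
rewrite big_split /= sumr_const card_ord -[g *+ n]mulr_natl; congr (_ + _).
by rewrite (bigD1 i) //= eqxx big1 ?addr0 // => j /negPf->.
Qed.

Lemma pair_dual g i j : 1 + n%:R * g != 0 ->
  ((e j + const_mx g) *m l (dual_shift g) i) 0 0 = (i == j)%:R.
Proof.
move=> g0; rewrite pair_shift sum_shift !mxE eqxx /= /dual_shift.
by rewrite mulNr divfK // addrK.
Qed.

Lemma dual_decomp g w : 1 + n%:R * g != 0 ->
  w = \sum_j (w *m l (dual_shift g) j) 0 0 *: (e j + const_mx g).
Proof.
move=> g0; under eq_bigr do rewrite pair_shift scalerDr.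
rewrite big_split /=; apply/rowP => k; rewrite mxE !summxE; set S := \sum_j w 0 j.
under eq_bigr do rewrite !mxE eqxx; under [X in _ = _ + X]eq_bigr do rewrite !mxE.
rewrite (bigD1 k) //= eqxx mulr1 big1 => [|i ik]; last by rewrite eq_sym (negPf ik) mulr0.
rewrite -mulr_suml big_split /= -/S sumr_const card_ord -mulr_natr /dual_shift.
by field.
Qed.

Lemma dirD_basis_eq0 g q : 1 + n%:R * g != 0 ->
  (forall j, dirD (e j + const_mx g) q = 0) -> forall w, dirD w q = 0.
Proof.
move=> g0 qg w; rewrite (dual_decomp w g0) dirD_suml big1 // => j _.
by rewrite dirDZl qg scaler0.
Qed.

(** The derivative of [f] along a basis vector is killed by the other ones, hence is a multiple of a
    power of the dual form; conciseness keeps the multiple nonzero. *)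
Lemma powers_of_jac d f g : f \is d.+3.-homog -> 1 + n%:R * g != 0 ->
    (forall v, dirD v f = 0 -> v = 0) ->
    (forall i j, i != j -> dirD (e i + const_mx g) (dirD (e j + const_mx g) f) = 0) ->
  exists c : 'I_n -> F, (forall i, c i != 0) /\
    f = \sum_i c i *: linform (l (dual_shift g) i) ^+ d.+3.
Proof.
move=> hf g0 fc fg; have d0 : d.+3%:R != 0 :> F by rewrite Num.Theory.pnatr_eq0.
have : forall i, exists a, dirD (e i + const_mx g) f =
    a *: linform (l (dual_shift g) i) ^+ d.+2.
  move=> i; apply: (homog_kernel_power (u := e i + const_mx g)).
  - exact: dhomog_dirD.
  - by rewrite pair_dual // eqxx.
  move=> v vi; rewrite (dual_decomp v g0) dirD_suml big1 // => j _; rewrite dirDZl.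
  by have [->|ji] := eqVneq j i; rewrite ?vi ?scale0r // fg ?scaler0.
case/fin_all_exists => a aE; exists (fun i => a i / d.+3%:R); split=> [i|].
  rewrite mulf_neq0 ?invr_eq0 //; apply/eqP => ai.
  have := aE i; rewrite ai scale0r => /fc vi.
  by have := pair_dual i i g0; rewrite vi mul0mx mxE eqxx => /esym/eqP; rewrite oner_eq0.
apply/eqP; rewrite -subr_eq0; apply/eqP; apply: (@homog_dirD_eq0 _ _ _ d.+2).
  by rewrite rpredB ?rpred_sum // => i _; rewrite rpredZ ?linform_homog.
apply: (dirD_basis_eq0 g0) => j; rewrite dirDBr dirD_sumr (bigD1 j) //= big1.
  rewrite dirDZr dirD_linform_exp pair_dual // eqxx mulr1 scalerA divfK // aE.
  by rewrite addr0 subrr.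
move=> i ij; rewrite dirDZr dirD_linform_exp pair_dual // (negPf ij) mulr0 scale0r.
by rewrite scaler0.
Qed.

(** As [t] is a multiple of the sum of the basis vectors [b i], the split condition would make all
    pure second derivatives along them equal. Each would be killed by every [b k], on choosing an
    index other than [k], so conciseness would fail. *)
Lemma powers_not_split d f g : (1 < n)%N -> f \is d.+3.-homog -> 1 + n%:R * g != 0 ->
    (forall v, dirD v f = 0 -> v = 0) ->
    (forall i j, i != j -> dirD (e i + const_mx g) (dirD (e j + const_mx g) f) = 0) ->
  ~ (forall i j, dirD t (dirD (e i - e j) f) = 0).
Proof.
move=> n2 hf g0 fc fg ft; pose b i := e i + const_mx g : 'rV[F]_n.
have tE i : dirD t (dirD (b i) f) = (1 + n%:R * g)^-1 *: dirD (b i) (dirD (b i) f).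
  rewrite (dual_decomp t g0) dirD_suml (bigD1 i) //= big1 ?addr0 => [|j ji]; last first.
    by rewrite dirDZl fg ?scaler0.
  rewrite dirDZl pair_shift; congr (_ *: _); under eq_bigr do rewrite mxE.
  by rewrite sumr_const card_ord mxE /dual_shift; field.
have bE i j : dirD (b i) (dirD (b i) f) = dirD (b j) (dirD (b j) f).
  have := ft i j; have -> : e i - e j = b i - b j by rewrite /b opprD addrACA subrr addr0.
  rewrite dirDBl dirDBr !tE -scalerBr => /eqP.
  by rewrite scaler_eq0 invr_eq0 (negPf g0) subr_eq0 => /eqP.
have b0 i : dirD (b i) (dirD (b i) f) = 0.
  apply: (@homog_dirD_eq0 _ _ _ d); first exact/dhomog_dirD/dhomog_dirD.
  apply: (dirD_basis_eq0 g0) => k; rewrite -/(b k).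
  have [j jk] : exists j, j \notin [:: k] by apply: fresh_ord.
  rewrite inE in jk.
  by rewrite (bE i j) dirDC (dirDC (b k)) fg // !dirD0r.
pose k := Ordinal n2.
have /fc vk : dirD (b k) f = 0.
  apply: (@homog_dirD_eq0 _ _ _ d.+1); first exact/dhomog_dirD.
  apply: (dirD_basis_eq0 g0) => i; have [->|ik] := eqVneq i k; first exact: b0.
  exact: fg.
have := pair_dual k k g0; rewrite -/(b k) vk mul0mx mxE eqxx => /esym/eqP.
by rewrite oner_eq0.
Qed.
End Families.

(** * Stability of the Jacobian and the case analysis *)

Section Forward.
Variables (F : numClosedFieldType) (n d : nat).
Implicit Types (f h p q : {mpoly F[n]}) (u v w x : 'rV[F]_n) (s : 'S_n).

Local Notation e i := (delta_mx 0 i : 'rV[F]_n).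
Local Notation t := (const_mx 1 : 'rV[F]_n).
Local Notation L := (linform (const_mx 1 : 'cV[F]_n)).

Definition jac_stable f := forall s v, exists w, dirD v (msym s f) = dirD w f.

(** [dirD t h = 0] encodes inflation from [H_n], and one scalar per permutation stands for the two
    symmetry types. *)
Definition split_form f := exists a h, [/\ h \is d.+3.-homog, dirD t h = 0,
  forall s, exists chi, msym s h = chi *: h & f = a *: L ^+ d.+3 + h].

Lemma jac_stable_line f : (forall s, exists c, msym s f = c *: f) -> jac_stable f.
Proof.
by move=> sf s v; have [c ->] := sf s; exists (c *: v); rewrite dirDZr dirDZl.
Qed.

Lemma jac_stable_split a h k : (0 < n)%N -> dirD t h = 0 ->
  (forall s, exists c, msym s h = c *: h) -> jac_stable (a *: L ^+ k.+1 + h).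
Proof.
move=> n_gt0 th sh s v; have n0 : n%:R != 0 :> F by rewrite Num.Theory.pnatr_eq0 -lt0n.
(* [c *: v] gives the right derivative of [h]; a multiple of [t], invisible to [h], then corrects
   the coefficient of the power of [L]. *)
have [c cE] := sh s; pose b := ((\sum_i v 0 i) - c * \sum_i v 0 i) / n%:R.
exists (c *: v + b *: t); rewrite msymD msymZ msym_linform1 cE !dirDDr !dirDZr.
rewrite [dirD (_ + _) h]dirDDl !dirDZl th scaler0 addr0; congr (_ *: _ + _).
rewrite !dirD_linform_exp pairD !pairZ pair_t pair1; congr ((_ * _) *: _).
by rewrite /b; field.
Qed.

Lemma jac_stable_powers (c : 'I_n -> F) g k : (forall i, c i != 0) -> 1 + n%:R * g != 0 ->
  jac_stable (\sum_i c i *: linform (e i + const_mx g)^T ^+ k.+1).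
Proof.
move=> c0 g0 s v; pose y i := (v *m (e (s i) + const_mx g : 'rV[F]_n)^T) 0 0.
have gg : dual_shift n (dual_shift n g) = g.
  rewrite /dual_shift; field; rewrite g0.
  by rewrite mulrN addrK oner_eq0.
(* [msym s] carries the [i]-th form to the [s i]-th. The dual basis yields a direction whose pairing
   with each form is that of [v], rescaled by the permuted coefficient over [c j]. *)
exists (\sum_j (c ((s^-1)%g j) * y ((s^-1)%g j) / c j) *: (e j + const_mx (dual_shift n g))).
pose w := \sum_j (c ((s^-1)%g j) * y ((s^-1)%g j) / c j) *: (e j + const_mx (dual_shift n g)) : 'rV[F]_n.
rewrite -/w; have wE i : (w *m (e i + const_mx g : 'rV[F]_n)^T) 0 0 = c ((s^-1)%g i) * y ((s^-1)%g i) / c i.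
  rewrite mulmx_suml summxE (bigD1 i) //= big1 => [|j ji]; rewrite pairZ.
    by rewrite -{2}gg pair_dual ?dual_shift_neq0 // eqxx mulr1 addr0.
  by rewrite -{2}gg pair_dual ?dual_shift_neq0 // eq_sym (negPf ji) mulr0.
rewrite (raddf_sum (msym s)) !dirD_sumr [RHS](reindex_inj (@perm_inj _ s)).
apply: eq_bigr => i _ /=; rewrite msymZ !dirDZr rmorphXn /= msym_linform.
rewrite (_ : (\col_j _) = (e (s i) + const_mx g : 'rV[F]_n)^T); last first.
  by apply/colP => j; rewrite !mxE !eqxx /= -(inj_eq (@perm_inj _ s)) permKV.
rewrite !dirD_linform_exp wE permK -/(y i) !scalerA; congr (_ *: _).
by field.
Qed.

Lemma jac_stable_rev f s x : jac_stable f -> exists y, dirD x f = dirD y (msym s f).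
Proof.
move=> /(_ s^-1%g (x *m perm_mx s^-1))[w wE]; exists (w *m perm_mx s).
rewrite msym_dirD mulmx_permK -wE msym_dirD invgK mulmx_permVK.
by rewrite -msymMm mulVg msym1m.
Qed.

(** [v] lies in this kernel exactly when [dirD v] kills the Jacobian, which is
    permutation-stable. *)
Lemma dirD_ker_perm f s v : f \is d.+3.-homog -> jac_stable f ->
  dirD v f = 0 -> dirD (v *m perm_mx s) f = 0.
Proof.
move=> hf jf vf; apply: (@homog_dirD_eq0 _ _ _ d.+1) => [|x]; first exact: dhomog_dirD.
have [y yE] := jac_stable_rev s x jf.
by rewrite dirDC yE dirDC msym_dirD mulmx_permK vf msym0 dirD0r.
Qed.

(** The second case keeps its witness so that it can be excluded when the lemma is applied to
    [f + L ^+ d.+3]. *)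
Lemma concise_class f : (4 < n)%N -> f \is d.+3.-homog -> jac_stable f ->
    (forall v, dirD v f = 0 -> v = 0) ->
  [\/ exists g, 1 + n%:R * g != 0 /\ forall i j, i != j ->
        dirD (e i + const_mx g) (dirD (e j + const_mx g) f) = 0,
      (exists i j, dirD t (dirD (e i - e j) f) <> 0) /\
      (forall s, exists chi, msym s f = chi *: f)
    | split_form f].
Proof.
move=> n5 hf jf fc.
have [M ME] : exists M : 'S_n -> 'M[F]_n, forall s v, dirD v (msym s f) = dirD (v *m M s) f.
  have [W WE] := fin_all_exists (fun s => fin_all_exists (fun i => jf s (e i))).
  exists (fun s => \matrix_i W s i) => s v.
  rewrite -[v in LHS]mulmx1 !dirD_mulmx; apply: eq_bigr => i _.
  by rewrite rowK row1 WE.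
have [|ZE] := hess_class n5 hf fc ME; first by constructor 1.
have [/forallP dt|/forallPn[i /forallPn[j /eqP dt]]] :=
    boolP [forall i, forall j, dirD t (dirD (e i - e j) f) == 0]; last first.
  constructor 2; split; first by exists i, j.
  by move=> s; apply: (jac_scalar hf fc ME s ZE dt).
constructor 3; apply: split_of_jac => // [|i j|s]; first exact: leq_trans n5.
  by have /forallP/(_ j)/eqP := dt i.
exact: jac_formula.
Qed.

Lemma linform1_neq0 : (0 < n)%N -> L != 0.
Proof.
move=> n_gt0; apply/negP => /eqP L0; have := dirD_linform (e (Ordinal n_gt0)) (const_mx 1).
rewrite L0 dirD0r pair_e => /esym/eqP; rewrite mpolyC1.
by rewrite oner_eq0.
Qed.

Lemma jac_stable_cases f : (4 < n)%N -> f \is d.+3.-homog -> jac_stable f ->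
  [\/ forall s, exists chi, msym s f = chi *: f,
      split_form f
    | exists (c : 'I_n -> F) g, [/\ forall i, c i != 0, 1 + n%:R * g != 0 &
        f = \sum_i c i *: linform (e i + const_mx g)^T ^+ d.+3]].
Proof.
move=> n5 hf jf; have n_gt0 : (0 < n)%N by apply: leq_trans n5.
have n0 : n%:R != 0 :> F by rewrite Num.Theory.pnatr_eq0 -lt0n.
(* The kernel of [v |-> dirD v f] is permutation-stable, so it contains all zero-sum vectors, making
   [f] a multiple of a power of [L], or lies in the line of [t]. *)
have [/forallP fH|/forallPn[i /forallPn[j /eqP fij]]] :=
    boolP [forall i, forall j, dirD (e i - e j) f == 0].
  constructor 2; have [v|a aE] := homog_kernel_power hf (pair_e _ (Ordinal n_gt0)).
    rewrite pair1 => v0; apply: (dirD_sum0 n5) => // i j.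
    by have /forallP/(_ j)/eqP := fH i.
  exists a, 0; split; rewrite ?dhomog0 ?dirD0r ?addr0 // => s.
  by exists 1; rewrite msym0 scaler0.
have ker v : dirD v f = 0 -> exists c, v = c *: t.
  move=> vf; exists (v 0 i); apply/rowP => k; rewrite !mxE mulr1; apply/eqP/negPn/negP => vik.
  apply: fij; apply: (perm_stable_subspace (P := fun v => dirD v f = 0) _ _ vf vik).
    by move=> a u w uf wf; rewrite dirDDl dirDZl uf wf scaler0 addr0.
  by move=> p q u uf; apply: dirD_ker_perm.
have [tf|tf] := eqVneq (dirD t f) 0; last first.
  have fc v : dirD v f = 0 -> v = 0.
    move=> vf; have [c vE] := ker v vf; move: vf; rewrite vE dirDZl => /eqP.
    by rewrite scaler_eq0 (negPf tf) orbF => /eqP->; rewrite scale0r.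
  have [[g [g0 fg]]|fs|fs] := concise_class n5 hf jf fc.
  - have [c [c0 fE]] := powers_of_jac hf g0 fc fg.
    by constructor 3; exists c, (dual_shift n g); split=> //; apply: dual_shift_neq0.
  - by case: fs => _; constructor 1.
  by constructor 2.
(* Here the kernel is the line of [t]; the added power gives a nonzero derivative along [t] and
   makes [p] concise. *)
pose p := f + L ^+ d.+3.
have hp : p \is d.+3.-homog by rewrite rpredD ?linform_homog.
have tp : dirD t p = (d.+3%:R * n%:R) *: L ^+ d.+2.
  by rewrite dirDDr tf add0r dirD_linform_exp pair_t.
have pc v : dirD v p = 0 -> v = 0.
  move=> vp; have := dirDC v t p; rewrite vp dirD0r tp dirDZr dirD_linform_exp pair1.
  move/eqP; rewrite !scaler_eq0 !mulf_eq0 !Num.Theory.pnatr_eq0 /= -leqn0 leqNgt n_gt0 /=.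
  rewrite expf_eq0 (negPf (linform1_neq0 n_gt0)) andbF orbF => /eqP v0.
  have [|c vE] := ker v.
    by move: vp; rewrite dirDDr dirD_linform_exp pair1 v0 mulr0 scale0r addr0.
  move: v0; rewrite vE; under eq_bigr do rewrite !mxE mulr1.
  rewrite sumr_const card_ord -mulr_natr => /eqP; rewrite mulf_eq0 (negPf n0) orbF.
  by move=> /eqP->; rewrite scale0r.
have Lperm s v : dirD v (msym s (L ^+ d.+3)) = (d.+3%:R * \sum_i v 0 i) *: L ^+ d.+2.
  by rewrite msym_linform1 dirD_linform_exp pair1.
have jp : jac_stable p.
  move=> s v; have [w wE] := jf s v.
  pose c := (\sum_i v 0 i - \sum_i w 0 i) / n%:R.
  exists (w + c *: t); rewrite msymD dirDDr wE Lperm dirDDr !dirDDl dirDZl tf scaler0 addr0.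
  rewrite dirDZl !dirD_linform_exp pair1 pair_t scalerA -scalerDl; congr (_ + _ *: _).
  by rewrite /c; field.
(* This vanishing leaves only the split case for [p]. *)
have dt i1 i2 : dirD t (dirD (e i1 - e i2) p) = 0.
  rewrite dirDC tp dirDZr dirD_linform_exp pairB !pair_e subrr mulr0 scale0r.
  by rewrite scaler0.
have [[g [g0 pg]]|ps|[a [h [hh th sh pE]]]] := concise_class n5 hp jp pc.
- by case: (powers_not_split (ltnW (ltnW (ltnW n5))) hp g0 pc pg).
- by case: ps => -[k [m]]; rewrite dt.
constructor 2; exists (a - 1), h; split=> //.
by rewrite scalerBl scale1r addrAC -pE addrK.
Qed.
End Forward.

(** * Polynomials as functions *)

Section Evaluation.
Variables (F : numFieldType) (n : nat).
Implicit Types (p q : {mpoly F[n]}) (v x : 'rV[F]_n).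

Local Notation "p @@ x" := (p.@[fun i => (x : 'rV[F]_n) 0 i]) (at level 2).

Lemma poly_eq0_eval (Q : {poly F}) : (forall c, Q.[c] = 0) -> Q = 0.
Proof.
move=> Q0; apply: (@roots_geq_poly_eq0 _ _ [seq i%:R | i <- iota 0 (size Q)]).
- by apply/allP => c _; apply/rootP.
- by rewrite map_inj_uniq ?iota_uniq // => i j /eqP; rewrite Num.Theory.eqr_nat => /eqP.
by rewrite size_map size_iota.
Qed.

Lemma deriv_eq0_const (Q : {poly F}) : Q^`() = 0 -> Q = (Q`_0)%:P.
Proof.
move=> dQ; apply/polyP => -[|i]; rewrite coefC //=; apply/eqP.
have /(congr1 (fun P : {poly F} => P`_i)) := dQ; rewrite coef_deriv coef0 => /eqP.
by rewrite -mulr_natr mulf_eq0 Num.Theory.pnatr_eq0 orbF.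
Qed.

Definition pline p x v : {poly F} := mmap polyC (fun i => (x 0 i)%:P + v 0 i *: 'X) p.

Lemma horner_pline p x v c : (pline p x v).[c] = p @@ (x + c *: v).
Proof.
rewrite /pline; elim/mpolyind: p => [|a m p _ _ IH]; first by rewrite mmap0 horner0 meval0.
rewrite mmapD mmapZ mmapX hornerD IH mevalD mevalZ mevalX hornerM hornerC; congr (_ * _ + _).
rewrite horner_prod; apply: eq_bigr => i _; rewrite horner_exp !hornerE !mxE.
by rewrite [v 0 i * c]mulrC.
Qed.

Lemma deriv_pline p x v : (pline p x v)^`() = pline (dirD v p) x v.
Proof.
rewrite /pline (@mderiv_chain _ _ _ (@deriv F) (mmap polyC _));
  [|exact: derivD|exact: derivM|by move=> c; rewrite /= mmapC derivC].
rewrite /dirD (raddf_sum (mmap polyC _)); apply: eq_bigr => i _ /=.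
rewrite mmapZ mmapX mmap1U derivD derivC derivZ derivX add0r mulrC.
by rewrite -mul_polyC mulr1.
Qed.

(** Restriction to lines shows that partial derivatives of a vanishing function vanish, so
    coefficients are reached by induction on the degree of the monomial. *)
Lemma meval_eq0 p : (forall x, p @@ x = 0) -> p = 0.
Proof.
move=> p0; apply/mpolyP => m; rewrite mcoeff0.
have [k] := ubnP (mdeg m); elim: k m p p0 => // k IH m p p0; rewrite ltnS => mk.
have [->|m0] := eqVneq m 0%MM.
  have := p0 0; rewrite (mpolyE p) raddf_sum /= => E; rewrite -{}E raddf_sum /=.
  apply: eq_bigr => m1 _; rewrite mcoeffZ mevalZ mcoeffX mevalX; congr (_ * _).
  have [->|] := eqVneq m1 0%MM.
    by rewrite big1 // => i _; rewrite mnm0E expr0.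
  by move/mnm_neq0=> [i mi]; rewrite (bigD1 i) //= mxE expr0n (negPf mi) mul0r.
have [i mi] := mnm_neq0 m0.
have mE : (m - U_(i) + U_(i))%MM = m by rewrite submK // lep1mP.
have := IH (m - U_(i))%MM p^`M(i); rewrite mcoeff_mderiv mE.
move=> /(_ _ _)/eqP; rewrite -mulr_natr mulf_eq0 Num.Theory.pnatr_eq0 orbF => H.
apply/eqP/H; last by rewrite -addn1 -(mdeg1 i) -mdegD mE.
move=> x; rewrite -dirD_delta -[x]addr0 -(scale0r (delta_mx 0 i)) -horner_pline -deriv_pline.
rewrite (_ : pline p x _ = 0) ?deriv0 ?horner0 //.
by apply: poly_eq0_eval => c; rewrite horner_pline.
Qed.

(** Links [dirD t h = 0] to being pulled back along the projection to [H_n]; both directions follow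
    by restriction to lines. *)
Lemma dirD_eq0_translation p v : dirD v p = 0 <-> forall x c, p @@ (x + c *: v) = p @@ x.
Proof.
split=> [vp x c|pv].
  have /deriv_eq0_const Q0 : (pline p x v)^`() = 0.
    by rewrite deriv_pline vp /pline mmap0.
  by rewrite -[x in RHS]addr0 -(scale0r v) -!horner_pline Q0 !hornerC.
apply: meval_eq0 => x; rewrite -[x]addr0 -(scale0r v) -horner_pline -deriv_pline.
rewrite (_ : pline p x v = (p @@ x)%:P) ?derivC ?horner0 //.
apply/eqP; rewrite -subr_eq0; apply/eqP/poly_eq0_eval => c.
by rewrite hornerD hornerN hornerC horner_pline pv subrr.
Qed.

Lemma meval_inj p q : (forall x, p @@ x = q @@ x) -> p = q.
Proof.
move=> pq; apply/eqP; rewrite -subr_eq0; apply/eqP/meval_eq0 => x.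
by rewrite mevalB pq subrr.
Qed.

End Evaluation.

(** * Translation to the notions of the statement *)

Section Bridge.
Variables (R : realType) (n : nat).
Local Notation C := (R[i]).
Implicit Types (f h : {mpoly C[n]}) (s : 'S_n) (d : nat).

Local Notation t := (const_mx 1 : 'rV[C]_n).

Lemma dirdE (v : 'rV[C]_n) f : dird v f = dirD v f.
Proof. by []. Qed.

Lemma sumXE : sumX R n = linform (const_mx 1).
Proof. by rewrite /sumX /linform; apply: eq_bigr => i _; rewrite mxE scale1r. Qed.

Lemma jacobianP f q : jacobian f q <-> exists v, q = dird v f.
Proof.
split=> [[k [c [g [gv ->]]]]|[v ->]].
  have /fin_all_exists[v vE] : forall j, exists v, g j = dird v f.
    by move=> j; have [v _ vE] := gv j; exists v.
  exists (\sum_j c j *: v j); rewrite dirdE dirD_suml; apply: eq_bigr => j _.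
  by rewrite vE dirdE dirDZl.
exists 1%N, (fun=> 1), (fun=> dird v f); split; first by move=> _; exists v.
by rewrite big_ord1 scale1r.
Qed.

Lemma Sn_invariant_jacobianP f : Sn_invariant (jacobian f) <-> jac_stable f.
Proof.
split=> [Jf s v|jf s].
  have [|w wE] := (jacobianP f (dird v (msym s f))).1; last by exists w; rewrite -!dirdE.
  rewrite -(Jf s); exists (dird (v *m perm_mx s^-1) f); first by apply/jacobianP; exists (v *m perm_mx s^-1).
  by rewrite !dirdE msym_dirD.
have Jsub r q : jacobian f q -> jacobian f (msym r q).
  case/jacobianP => v ->; have [w wE] := jf r (v *m perm_mx r).
  by apply/jacobianP; exists w; rewrite !dirdE -wE msym_dirD mulmx_permK.
apply/seteqP; split=> [_ [q Jq <-]|q Jq]; first exact: Jsub.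
by exists (msym s^-1 q); [exact: Jsub | rewrite -msymMm mulVg msym1m].
Qed.

Lemma spanset1P f q : spanset [set f]%classic q <-> exists c, q = c *: f.
Proof.
split=> [[k [c [g [gf ->]]]]|[c ->]].
  exists (\sum_j c j); rewrite scaler_suml; apply: eq_bigr => j _.
  by rewrite (gf j).
by exists 1%N, (fun=> c), (fun=> f); split; rewrite ?big_ord1.
Qed.

Lemma line_invariantP f : line_invariant f <-> forall s, exists c, msym s f = c *: f.
Proof.
split=> [If s|sf s].
  apply/spanset1P; rewrite -(If s); exists f => //.
  by apply/spanset1P; exists 1; rewrite scale1r.
have Isub r q : spanset [set f]%classic q -> spanset [set f]%classic (msym r q).
  case/spanset1P => c ->; have [b bE] := sf r; apply/spanset1P.
  by exists (c * b); rewrite msymZ bE scalerA.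
apply/seteqP; split=> [_ [q Iq <-]|q Iq]; first exact: Isub.
by exists (msym s^-1 q); [exact: Isub | rewrite -msymMm mulVg msym1m].
Qed.

Lemma line_invariant_cases f : line_invariant f <-> f \is symmetric \/ alternating f.
Proof.
rewrite line_invariantP; split=> [/semi_invariant_cases[fs|fa]|[/issymP fs|fa] s].
- by left; apply/issymP.
- by right.
- by exists 1; rewrite fs scale1r.
by exists ((-1) ^+ s); rewrite fa.
Qed.

Lemma projHn_perm s (x : 'rV[C]_n) : (0 < n)%N ->
  projHn (permV s x) = permHn s (projHn x).
Proof.
move=> n_gt0; apply: subvs_inj; rewrite permHnE !projHnE //.
rewrite (_ : \sum_i permV s x 0 i = \sum_i x 0 i); last first.
  rewrite [RHS](reindex_inj (@perm_inj _ s^-1)%g).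
  by apply: eq_bigr => i _; rewrite permVE.
by apply/rowP => i; rewrite permVE !mxE.
Qed.

Lemma projHn_shift c (x : 'rV[C]_n) : (0 < n)%N -> projHn (x + c *: t) = projHn x.
Proof.
move=> n_gt0; have n0 : n%:R != 0 :> C by rewrite Num.Theory.pnatr_eq0 -lt0n.
apply: subvs_inj; rewrite !projHnE //.
have -> : \sum_i (x + c *: t) 0 i = \sum_i x 0 i + c * n%:R.
  under eq_bigr do rewrite !mxE mulr1.
  by rewrite big_split /= sumr_const card_ord mulr_natr.
rewrite mulrDl mulfK //; apply/rowP => i; rewrite !mxE mulr1.
by rewrite opprD addrACA subrr addr0.
Qed.

(** The form on [H_n] is the restriction of [h]; translation invariance along [t] makes [h] its
    inflation. *)
Lemma split_family_of_form d f : (0 < n)%N -> split_form d f -> split_family d.+3 f.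
Proof.
move=> n_gt0 [a [h [hh th sh fE]]].
exists a, h, (fun y => evalP h (vsval y)); split; rewrite ?sumXE //.
- by exists h.
- have [hs|ha] := semi_invariant_cases sh; [left|right] => s y.
    by rewrite permHnE -evalP_msym hs.
  by rewrite permHnE -evalP_msym ha /evalP mevalZ.
move=> x; rewrite projHnE //; set c := _ / _.
have -> : x - const_mx c = x + (- c) *: t.
  by apply/rowP => i; rewrite !mxE mulr1.
by rewrite /evalP (dirD_eq0_translation _ _).1.
Qed.

Lemma jac_stable_split_family d f : (0 < n)%N -> split_family d.+1 f -> jac_stable f.
Proof.
move=> n_gt0 [a [h [g [_ gs gh fE]]]].
have hE s : exists c, msym s h = c *: h.
  have [c gE] : exists c, forall y, g (permHn s^-1 y) = c * g y.
    by case: gs => gs; [exists 1 | exists ((-1) ^+ s)] => y; rewrite gs ?mul1r.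
  exists c; apply: meval_inj => x; rewrite mevalZ -!/(evalP _ _) evalP_msym !gh.
  by rewrite projHn_perm // gE.
have th : dirD t h = 0.
  apply/dirD_eq0_translation => x c; rewrite -!/(evalP _ _) !gh.
  by rewrite projHn_shift.
by rewrite fE sumXE; apply: jac_stable_split.
Qed.

Lemma powers_familyE d f : powers_family d f <->
  exists (c : 'I_n -> C) g, [/\ forall i, c i != 0, 1 + n%:R * g != 0 &
    f = \sum_i c i *: linform (delta_mx 0 i + const_mx g)^T ^+ d].
Proof.
have E g i : 'X_i + g *: sumX R n = linform (delta_mx 0 i + const_mx g)^T.
  by rewrite linform_shift sumXE.
split=> -[c [g [c0 g0 fE]]]; exists c, g; split; [exact: c0 | exact: g0 | | exact: c0 | exact: g0 | ];
  rewrite fE; apply: eq_bigr => i _; by rewrite E.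
Qed.

End Bridge.

Theorem theorem4p6 (R : realType) (n d : nat) (f : {mpoly R[i][n]}) :
  (5 <= n)%N -> (3 <= d)%N -> f \is d.-homog -> f != 0 ->
  (line_invariant f <-> f \is symmetric \/ alternating f) /\
  (Sn_invariant (jacobian f) <->
     line_invariant f \/ split_family d f \/ powers_family d f).
Proof.
(* From here on [d] is the degree minus 3. *)
case: d => [|[|[|d]]] // n5 _ hf _; have n_gt0 : (0 < n)%N by apply: leq_trans n5.
split; first exact: line_invariant_cases.
rewrite Sn_invariant_jacobianP line_invariantP powers_familyE; split.
  case/(jac_stable_cases n5 hf) => [|/(split_family_of_form n_gt0)|]; first by left.
    by right; left.
  by right; right.
case=> [|[|[c [g [c0 g0 ->]]]]]; first exact: jac_stable_line.
  exact: jac_stable_split_family.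
exact: jac_stable_powers.
Qed.
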